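(* Let $3\le k\le \lceil n/2\rceil$ and let $\Gamma_n^k$ be the set of all trees on $n$ vertices with diameter $k$. Then over $\Gamma_n^k$, the distance $d_T(C_d(T),\chi(T))$ between the centroid and the characteristic set is maximized by the tree $T\big(n-\lfloor n/2\rfloor-k+1,\ \lfloor n/2\rfloor,\ k-1\big)$.
   Context: For positive integers $l,m,p$, $T(l,m,p)$ denotes the tree on $l+m+p$ vertices obtained from the path $v_1v_2\cdots v_p$ by adding $l$ pendant vertices adjacent to $v_1$ and $m$ pendant vertices adjacent to $v_p$ (it has diameter $p+1$). For subsets $U,V$ of vertices of a tree $T$, $d_T(U,V)=\min\{d(u,v):u\in U,v\in V\}$ with $d(u,v)$ the number of edges on the $u$–$v$ path. A branch at $v$ is a maximal subtree containing $v$ as a pendant vertex; the weight of $v$ is the maximum number of edges in a branch at $v$; the centroid $C_d(T)$ is the set of vertices of minimum weight. Characteristic set: let $L(T)=D(T)-A(T)$ be the Laplacian matrix, $\mu$ its second smallest eigenvalue and $Y$ an eigenvector for $\mu$. A vertex $v$ is a characteristic vertex if $Y(v)=0$ and some neighbour $u$ has $Y(u)\neq0$; an edge $\{u,v\}$ is a characteristic edge if $Y(u)Y(v)<0$; $\chi(T)$ is the set of characteristic vertices and edges (a single vertex or a single edge for a tree, independent of $Y$). An edge is regarded as the set of its two endpoints when computing distances. *)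

(* Defs.v *)
From mathcomp Require Import all_boot all_order all_algebra.
From mathcomp Require Import reals.

Set Implicit Arguments.
Unset Strict Implicit.
Unset Printing Implicit Defensive.

Import GRing.Theory Num.Theory.

(* A simple graph is given by its adjacency relation on a finite type. *)

Section Tree.
Variables (V : finType) (e : rel V).

(* The bound on the size discards the closed walks x, y, x. *)
Definition acyclic := forall c : seq V, ucycle e c -> size c <= 2.

Definition is_tree :=
  [/\ symmetric e, irreflexive e, 0 < #|V|,
      (forall x y, connect e x y) & acyclic].

(* Length of a shortest walk from u to v, which in a tree is the u-v path
   (#|V| if v is not reachable from u). *)
Definition dist (u v : V) : nat :=
  find (fun d => [exists p : d.-tuple V, path e u p && (last u p == v)])
       (iota 0 #|V|).

Definition diameter : nat := \max_(u : V) \max_(v : V) dist u v.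

(* Distances in a connected graph are smaller than the default value #|V|,
   which is thus only reached when A or B is empty. *)
Definition set_dist (A B : {set V}) : nat :=
  \big[minn/#|V|]_(u in A) \big[minn/#|V|]_(v in B) dist u v.

(* A connected subgraph of a tree contains every edge of the tree between its
   vertices, so subtrees are represented by their vertex sets. *)
Definition connected_set (S : {set V}) : bool :=
  [forall x in S, forall y in S, connect [rel a b in S | e a b] x y].

Definition edges_in (S : {set V}) : {set {set V}} :=
  [set A : {set V} |
    [exists x in S, exists y in S, e x y && (A == [set x; y])]].

Definition subtree_pendant_at (v : V) (S : {set V}) : bool :=
  [&& v \in S, connected_set S & #|[set u in S | e v u]| == 1].

Definition branch (v : V) (S : {set V}) : bool :=
  maxset (subtree_pendant_at v) S.

Definition weight (v : V) : nat :=
  \max_(S : {set V} | branch v S) #|edges_in S|.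

Definition centroid : {set V} :=
  [set v | [forall u, weight v <= weight u]].

Definition degree (v : V) : nat := #|[set u | e v u]|.

End Tree.

(* The set \Gamma_n^k of trees on n vertices with diameter k. *)
Definition Gamma (n k : nat) (V : finType) (e : rel V) : Prop :=
  [/\ #|V| = n, is_tree e & diameter e = k].

(* The tree T(l,m,p): inl i is the path vertex v_(i+1), inr (inl _) are the
   vertices pendant at v_1 and inr (inr _) those pendant at v_p. *)
Definition Tlmp (l m p : nat) : rel ('I_p + ('I_l + 'I_m))%type :=
  fun x y => match x, y with
  | inl i, inl j => (i.+1 == j :> nat) || (j.+1 == i :> nat)
  | inl i, inr (inl _) | inr (inl _), inl i => i == 0 :> nat
  | inl i, inr (inr _) | inr (inr _), inl i => i.+1 == p
  | inr _, inr _ => false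
  end.

Local Open Scope ring_scope.

(* Counted with multiplicity. *)
Definition second_smallest_eigenvalue (R : realType) (n : nat)
    (A : 'M[R]_n) (mu : R) : Prop :=
  exists s : seq R, [/\ sorted <=%R s,
    char_poly A = \prod_(a <- s) ('X - a%:P), (1 < size s)%N & s`_1 = mu].

Section Laplacian.
Variables (R : realType) (V : finType) (e : rel V).

(* Rows and columns are indexed by the vertices through enum_val. *)
Definition degree_mx : 'M[R]_#|V| :=
  diag_mx (\row_i (degree e (enum_val i))%:R).

Definition adjacency_mx : 'M[R]_#|V| :=
  \matrix_(i, j) (e (enum_val i) (enum_val j))%:R.

Definition laplacian : 'M[R]_#|V| := degree_mx - adjacency_mx.

Definition fiedler_vector (Y : 'cV[R]_#|V|) : Prop :=
  exists mu : R, [/\ second_smallest_eigenvalue laplacian mu,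
    Y != 0 & laplacian *m Y = mu *: Y].

Definition entry (Y : 'cV[R]_#|V|) (v : V) : R := Y (enum_rank v) 0.

Definition characteristic_vertices (Y : 'cV[R]_#|V|) : {set V} :=
  [set v | (entry Y v == 0) && [exists u, e v u && (entry Y u != 0)]].

Definition characteristic_edges (Y : 'cV[R]_#|V|) : {set {set V}} :=
  [set A : {set V} | [exists u, exists v,
    [&& e u v, entry Y u * entry Y v < 0 & A == [set u; v]]]].

(* Characteristic vertices appear as singletons; the vertices involved in
   X are then those of cover X. *)
Definition is_characteristic_set (X : {set {set V}}) : Prop :=
  exists Y, fiedler_vector Y /\
    X = [set [set v] | v in characteristic_vertices Y]
        :|: characteristic_edges Y.

End Laplacian.

Definition centroid_dist (V : finType) (e : rel V) (X : {set {set V}}) : nat :=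
  set_dist e (centroid e) (cover X).

(* Main.v *)
Require Import Defs.
From mathcomp Require Import all_boot all_order all_algebra.
From mathcomp Require Import reals complex spectral sesquilinear.
From mathcomp Require Import zify ring lra boolp.

Set Implicit Arguments.
Unset Strict Implicit.
Unset Printing Implicit Defensive.

Import Order.TTheory GRing.Theory Num.Theory.

(** Suppose that the distance D from the centroid to the characteristic set is
realised by c and r, and delete r: let A be the branch containing c, and B the
union of the other ones. As r is characteristic, some function on B vanishing at
r has Rayleigh quotient at most the algebraic connectivity mu. Let r0 be the
vertex of the extremal tree at distance D from its centroid, and A0, B0 the
corresponding parts, with connectivity mu0. The Green kernel of a branch counts
the common edges of the paths to the root, and it increases entrywise along
suitable injections A0 -> A (as more than half of the vertices lie beyond the
centroid) and B -> B0 (as B0 has the least number of vertices at each small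
distance). So least Dirichlet eigenvalues satisfy lambda(A) <= lambda(A0) and
lambda(B0) <= lambda(B). If lambda(A0) < mu0, then mu < mu0, since two separated
functions cannot have quotients at most mu and less than mu respectively; then
lambda(B0) <= mu < mu0 and the same principle fails on the extremal tree. Hence
lambda(A0) >= mu0, which keeps the characteristic set of the extremal tree out
of A0, at distance at least D from its centroid. *)

(** * Shortest walks in a connected graph *)

Lemma path_rev_belast (T : Type) (e : rel T) x p : symmetric e ->
  path e x p -> path e (last x p) (rev (belast x p)).
Proof. by move=> sym; rewrite rev_path (eq_path (e' := e)) // => u v; rewrite sym. Qed.

Lemma last_rev_belast (T : Type) (x : T) p :
  last (last x p) (rev (belast x p)) = x.
Proof. by case: p => //= y p; rewrite rev_cons last_rcons. Qed.

Section Distance.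
Variables (V : finType) (e : rel V).
Implicit Types (x y z : V) (p : seq V).

Lemma dist_path x p : path e x p -> dist e x (last x p) <= size p.
Proof.
move=> pp; rewrite leqNgt; apply/negP => lt; move: (lt).
rewrite /dist; set P := (X in find X) => lt'.
have := before_find 0 lt'; rewrite nth_iota ?add0n; last first.
  by apply: (leq_trans lt'); apply: (leq_trans (find_size _ _)); rewrite size_iota.
by move/existsP; case; exists (in_tuple p); rewrite pp eqxx.
Qed.

Hypothesis conn : forall x y, connect e x y.

(** A connecting walk shortens to one without repeated vertices, hence of length below [#|V|], so
    the search in [dist] succeeds before its default value. *)
Lemma dist_geodesic x y :
  exists p, [/\ size p = dist e x y, path e x p & last x p = y].
Proof.
have [p pp ->] := connectP (conn x y).
have [q pq uq _] := shortenP pp.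
have sq : size q < #|V|.
  by have := max_card (mem (x :: q)); rewrite (card_uniqP uq).
suff [n -> [r [<- pr lr]]] : exists2 n, n = dist e x (last x q) &
    exists r, [/\ size r = n, path e x r & last x r = last x q] by exists r.
eexists; first by []; rewrite /dist; set P := (X in find X).
have hasP : has P (iota 0 #|V|).
  apply/hasP; exists (size q); rewrite ?mem_iota //.
  by apply/existsP; exists (in_tuple q); rewrite pq eqxx.
have := nth_find 0 hasP; rewrite has_find size_iota in hasP.
rewrite nth_iota // add0n => /existsP[r /andP[pr /eqP lr]].
by exists r; rewrite size_tuple.
Qed.

Lemma dist_lt x y : dist e x y < #|V|.
Proof.
have [p pp ->] := connectP (conn x y); have [q pq uq _] := shortenP pp.
apply: leq_ltn_trans (dist_path pq) _.
by have := max_card (mem (x :: q)); rewrite (card_uniqP uq).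
Qed.

Lemma distxx x : dist e x x = 0.
Proof. by apply/eqP; rewrite -leqn0; exact: (@dist_path x [::]). Qed.

Lemma dist_eq0 x y : (dist e x y == 0) = (x == y).
Proof.
apply/eqP/eqP => [d0|->]; last exact: distxx.
have [p [sp _ <-]] := dist_geodesic x y.
by move: sp; rewrite d0 => /size0nil ->.
Qed.

Lemma dist_adjacent x y z : e x z -> dist e x y <= (dist e z y).+1.
Proof.
move=> exz; have [p [<- pp <-]] := dist_geodesic z y.
by apply: (@dist_path x (z :: p)); rewrite /= exz.
Qed.

Lemma dist_descent x y : x != y ->
  exists2 z, e x z & dist e x y = (dist e z y).+1.
Proof.
rewrite -dist_eq0; have [[|z p] [sp //= pp lp]] := dist_geodesic x y.
  by rewrite -sp.
move=> _; have /andP[exz pz] := pp; exists z => //.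
apply/eqP; rewrite eqn_leq dist_adjacent //= -sp /= ltnS -lp.
exact: dist_path.
Qed.

Lemma dist_triangle x y z : dist e x z <= dist e x y + dist e y z.
Proof.
have [p [<- pp lp]] := dist_geodesic x y; have [q [<- pq lq]] := dist_geodesic y z.
rewrite -size_cat; have -> : z = last x (p ++ q) by rewrite last_cat lp.
by apply: dist_path; rewrite cat_path pp lp.
Qed.

(** Descent produces a walk of length [D x y], and along a geodesic [D] drops by at most one per
    edge. These local conditions are the ones checked for the explicit distance on [Tlmp]. *)
Lemma dist_uniq (D : V -> V -> nat) :
    (forall x, D x x = 0) ->
    (forall x y z, e x z -> D x y <= (D z y).+1) ->
    (forall x y, x != y -> exists2 z, e x z & D x y = (D z y).+1) ->
  dist e =2 D.
Proof.
move=> D0 Dle Ddesc x y; apply/eqP; rewrite eqn_leq; apply/andP; split.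
  have [n] := ubnP (D x y); elim: n x => // n IHn x ltn.
  have [->|neq] := eqVneq x y; first by rewrite distxx.
  have [z exz Dxy] := Ddesc _ _ neq.
  rewrite Dxy; apply: leq_trans (dist_adjacent _ exz) _.
  by rewrite ltnS IHn // -ltnS -Dxy.
have [p [<- pp <-]] := dist_geodesic x y.
elim: p x pp => [|z p IHp] x /=; first by rewrite D0.
case/andP=> exz pz; apply: leq_trans (Dle _ _ _ exz) _; rewrite ltnS; exact: IHp.
Qed.

Hypothesis sym : symmetric e.

Lemma distC x y : dist e x y = dist e y x.
Proof.
wlog suff le : x y / dist e x y <= dist e y x.
  by apply/eqP; rewrite eqn_leq !le.
have [p [<- pp <-]] := dist_geodesic y x.
rewrite -(size_belast y p) -(size_rev (belast y p)).
by have := dist_path (path_rev_belast sym pp); rewrite last_rev_belast.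
Qed.

Lemma dist_adjacent_sym x y z : e x z -> dist e z y <= (dist e x y).+1.
Proof. by rewrite sym; exact: dist_adjacent. Qed.

End Distance.

(** * Distances and branches in a tree *)

Section TreeMetric.
Variables (V : finType) (e : rel V).
Hypothesis tree : is_tree e.
Implicit Types (a b x y z : V).
Local Notation d := (dist e).

Lemma tree_conn x y : connect e x y. Proof. by case: tree. Qed.
Lemma tree_sym : symmetric e. Proof. by case: tree. Qed.
Lemma tree_irr x : e x x = false. Proof. by case: tree. Qed.

Local Notation conn := tree_conn.
Local Notation sym := (tree_sym).

(** Otherwise a simple path from [a] to [b] avoiding [x], closed up through [x], would be a cycle on
    at least three vertices. *)
Lemma tree_separates x a b p : e x a -> e x b -> path e a p -> last a p = b ->
  x \notin a :: p -> a = b.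
Proof.
move=> exa exb pp lp; rewrite -lp => xp; apply/eqP/negPn/negP => neq.
case: (shortenP pp) lp neq xp => q pq uq sub lq neq xp.
have xq : x \notin a :: q.
  apply: contra xp; rewrite !inE => /orP[->//|/sub ->]; exact: orbT.
case: tree => _ _ _ _ /(_ (x :: a :: q)).
rewrite /ucycle /= rcons_path pq exa lq sym exb /= => xcyc.
have {}/xcyc : uniq (x :: a :: q) by rewrite cons_uniq xq uq.
by case: q neq {pq uq sub lq xq} => [|? ?] /=; [rewrite eqxx | lia].
Qed.

Lemma geodesic_avoids x y a : e x a -> x != y -> d a y <= d x y ->
  exists p, [/\ path e a p, last a p = y & x \notin a :: p].
Proof.
move=> exa nxy le; have [p [sp pp lp]] := dist_geodesic conn a y.
exists p; split=> //; apply/negP; rewrite inE => /orP[/eqP xa|xp].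
  by rewrite xa tree_irr in exa.
case/splitPr: xp sp pp lp => p1 p2; rewrite size_cat /= cat_path last_cat /=.
move=> sp /and3P[_ _ p2p] lp; have := dist_path p2p; rewrite lp; lia.
Qed.

(** The geodesics from [a] and [b] to [y] avoid [x]; joined at [y], they connect two neighbours of
    [x] without meeting it. Acyclicity enters the later arguments in this form. *)
Lemma dist_descent_uniq x y a b : x != y -> e x a -> e x b ->
  d a y <= d x y -> d b y <= d x y -> a = b.
Proof.
move=> nxy exa exb /(geodesic_avoids exa nxy)[p [pp lp xp]].
move=> /(geodesic_avoids exb nxy)[q [pq lq xq]].
apply: (@tree_separates x a b (p ++ rev (belast b q))) => //.
- by rewrite cat_path pp lp -lq; exact: path_rev_belast sym pq.
- by rewrite last_cat lp -lq last_rev_belast.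
- rewrite -cat_cons mem_cat negb_or xp mem_rev.
  by apply: contra xq => /mem_belast.
Qed.

(** For [x] other than [y], only the descending neighbour of [x] is no farther from [y] than [x];
    every other neighbour is farther. *)
Lemma dist_parity x y z : e x z -> d x y = (d z y).+1 \/ d z y = (d x y).+1.
Proof.
move=> exz; have := dist_adjacent conn y exz; have := dist_adjacent_sym conn sym y exz.
have [xy|nxy] := eqVneq x y.
  have : d z y != 0.
    rewrite (dist_eq0 conn) -xy; apply: contraL exz => /eqP ->.
    by rewrite tree_irr.
  rewrite xy distxx; lia.
have [a exa dxa] := dist_descent conn nxy => le1 le2.
have [ltz|ltz] := leqP (d z y) (d x y); last lia.
by left; rewrite (@dist_descent_uniq x y z a) //; lia.
Qed.

(** For an edge between [a] and [r] this is the component of [a] once the edge is deleted; together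
    with [r] it is the branch at [r] through [a]. *)
Definition side a r : {set V} := [set x | d a x < d r x].

Lemma in_side a r x : (x \in side a r) = (d a x < d r x).
Proof. by rewrite inE. Qed.

Lemma side_dist a r x : e a r -> x \in side a r -> d r x = (d a x).+1.
Proof. by move=> ear; rewrite in_side; case: (dist_parity x ear); lia. Qed.

Lemma sideN_dist a r x : e a r -> x \notin side a r -> d a x = (d r x).+1.
Proof. by move=> ear; rewrite in_side; case: (dist_parity x ear); lia. Qed.

Lemma side_root a r : e a r -> a \in side a r.
Proof.
move=> ear; rewrite in_side distxx lt0n (dist_eq0 conn).
by apply: contraL ear => /eqP ->; rewrite tree_irr.
Qed.

Lemma sideN_root a r : r \notin side a r.
Proof. by rewrite in_side distxx. Qed.

Lemma sideC a r : e a r -> ~: side a r = side r a.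
Proof.
move=> ear; apply/setP => x; rewrite inE !in_side.
by case: (dist_parity x ear); lia.
Qed.

(** If [z] were not [r], its neighbour towards [r] would, like [x], be its neighbour towards [a],
    hence equal to [x]; yet [x] is farther from [r] than [z]. *)
Lemma side_exit a r x z : e a r -> e x z -> x \in side a r ->
  z \notin side a r -> x = a /\ z = r.
Proof.
move=> ear exz xs zs; have xr := side_dist ear xs; have za := sideN_dist ear zs.
have := dist_parity r exz; have := dist_parity a exz.
rewrite ![d x _](distC conn sym) ![d z _](distC conn sym) => pa pr.
have zr : z = r.
  apply/eqP/negPn/negP => nzr; have [w ezw dzw] := dist_descent conn nzr.
  have nza : z != a by apply: contraNneq zs => ->; apply: side_root.
  have xw : x = w.
    apply: (@dist_descent_uniq z a) => //; rewrite 1?sym //.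
      rewrite ![d _ a](distC conn sym); lia.
    have := dist_triangle conn w r a;
    have := dist_parity w ear; rewrite ![d _ w](distC conn sym).
    rewrite !(distC conn sym _ r) !(distC conn sym _ a) in dzw *; lia.
  rewrite -xw !(distC conn sym _ r) in dzw; lia.
split=> //; apply/eqP; rewrite eq_sym -(dist_eq0 conn) -eqSS -xr.
by rewrite zr distxx in za pr pa; apply/eqP; lia.
Qed.

Lemma dist_cut a r x y : e a r -> x \in side a r -> y \notin side a r ->
  d x y = d x a + (d r y).+1.
Proof.
move=> ear xs ys; apply/eqP; rewrite eqn_leq; apply/andP; split.
  by rewrite -(sideN_dist ear ys); exact: dist_triangle conn _ _ _.
have [n] := ubnP (d x y); elim: n x xs => // n IHn x xs ltn.
have nxy : x != y by apply: contraNneq ys => <-.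
have [w exw dxw] := dist_descent conn nxy.
have [ws|ws] := boolP (w \in side a r).
  have := IHn w ws; have := dist_adjacent conn a exw; lia.
have [xa wr] := side_exit ear exw xs ws.
by rewrite dxw wr xa distxx.
Qed.

Lemma dist_side_root a r x y : e a r -> x \in side a r -> y \notin side a r ->
  d x y = d r x + d r y.
Proof.
move=> ear xs ys; rewrite (dist_cut ear xs ys) (side_dist ear xs).
by rewrite (distC conn sym x); lia.
Qed.


Lemma side_cover v x : x != v -> exists2 a, e v a & x \in side a v.
Proof.
rewrite eq_sym => nvx; have [a eva dvx] := dist_descent conn nvx.
by exists a; rewrite // in_side dvx.
Qed.

Lemma side_disjoint a b r x : e r a -> e r b ->
  x \in side a r -> x \in side b r -> a = b.
Proof.
rewrite !in_side => era erb ltax ltbx.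
apply: (@dist_descent_uniq r x) => //; try exact: ltnW.
by apply: contraTneq ltax => ->; rewrite distxx.
Qed.

Lemma side_sub a c r x : e r a -> e r c -> a != c ->
  x \in side a r -> (x \in side r c) && (x != r).
Proof.
move=> era erc nac xa; apply/andP; split; last first.
  by apply: contraTneq xa => ->; exact: sideN_root.
rewrite -sideC 1?sym // inE.
by apply: contra nac => xc; apply/eqP; exact: side_disjoint xa xc.
Qed.

Lemma path_in_side a r x p : e a r -> x \in side a r -> path e x p ->
  r \notin p -> last x p \in side a r.
Proof.
move=> ear; elim: p x => //= z p IHp x xs /andP[exz pz].
rewrite inE negb_or => /andP[nrz rp]; apply: IHp => //.
apply: contraTT xs => zs; apply/negP => xs.
by have [_ zr] := side_exit ear exz xs zs; rewrite zr eqxx in nrz.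
Qed.

Lemma side_connect a r x : e a r -> x \in side a r ->
  connect [rel u v in side a r | e u v] x a.
Proof.
move=> ear; have [n] := ubnP (d x a); elim: n x => // n IHn x ltn xs.
have [->//|nxa] := eqVneq x a.
have [z exz dxa] := dist_descent conn nxa.
have zs : z \in side a r.
  apply: contraNT nxa => zs; apply/eqP.
  by have [] := side_exit ear exz xs zs.
apply: connect_trans (IHn z _ zs); last by rewrite -ltnS -dxa.
by apply: connect1; rewrite /= xs zs exz.
Qed.

Lemma side_connected a r : e a r -> connected_set e (r |: side a r).
Proof.
move=> ear; set S := r |: _.
have symS : symmetric [rel u v in S | e u v].
  by move=> u v /=; rewrite sym [(u \in S) && _]andbC.
have toa x : x \in S -> connect [rel u v in S | e u v] x a.
  rewrite in_setU1 => /orP[/eqP ->|xs].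
    by apply: connect1; rewrite /= !in_setU1 eqxx side_root // orbT sym ear.
  apply: connect_sub (side_connect ear xs) => u v /=.
  case/andP=> /andP[us vs] euv; apply: connect1.
  by rewrite /= !in_setU1 us vs euv !orbT.
apply/forall_inP => x xS; apply/forall_inP => y yS.
by apply: connect_trans (toa x xS) _; rewrite (sym_connect_sym symS) toa.
Qed.

Lemma side_pendant a r : e a r -> subtree_pendant_at e r (r |: side a r).
Proof.
move=> ear; rewrite /subtree_pendant_at setU11 side_connected //=.
apply/cards1P; exists a; apply/setP => x; rewrite !inE.
have [->|nxa] := eqVneq x a.
  by rewrite -in_side side_root ?orbT // sym ear.
apply/negP => /andP[/orP[/eqP ->|]]; first by rewrite tree_irr.
rewrite -in_side => xs erx; move/eqP: nxa; apply.
apply: (side_disjoint (r := r) (x := x)) => //; first by rewrite sym.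
by apply: side_root; rewrite sym.
Qed.

(** Inside [S] a simple path from [r] starts through the single neighbour [a] of [r] and never
    returns to [r], so it stays on the side of [a]. With [side_pendant], this reduces weights to
    cardinals of sides. *)
Lemma pendant_sub_side r S : subtree_pendant_at e r S ->
  exists2 a, e r a & S \subset r |: side a r.
Proof.
case/and3P=> rS /forall_inP conS /cards1P[a Sa].
have /setIdP[aS era] : a \in [set u in S | e r u] by rewrite Sa set11.
exists a => //; apply/subsetP => x xS; rewrite in_setU1.
have [//|nxr /=] := eqVneq x r.
have /forall_inP/(_ x xS)/connectP[p pp xp] := conS _ rS.
rewrite {}xp in nxr *; case: (shortenP pp) nxr => -[|z q]; first by rewrite eqxx.
rewrite /= => /andP[/andP[/andP[_ zS] erz] pz] /andP[rq _] _ _.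
have za : z = a by apply/set1P; rewrite -Sa inE zS erz.
rewrite -za; rewrite in_cons negb_or in rq; case/andP: rq => _ rq.
apply: path_in_side rq; rewrite 1?sym ?side_root // 1?sym //.
by apply: sub_path pz => u v /= /andP[].
Qed.

(** Each vertex of the side is matched with the edge to its neighbour towards [r], here [par]. *)
Lemma card_edges_side a r : e a r -> #|edges_in e (r |: side a r)| = #|side a r|.
Proof.
move=> ear; set S := r |: _.
pose par x := odflt x [pick z | e x z & d x r == (d z r).+1].
have parP x : x \in side a r -> [/\ e x (par x), d x r = (d (par x) r).+1 & par x \in S].
  move=> xs; have nxr : x != r by apply: contraTneq xs => ->; exact: sideN_root.
  rewrite /par; case: pickP => [z /andP[exz /eqP dxz]|none] /=.
    split=> //; rewrite in_setU1; have [//|nzr] := eqVneq z r.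
    apply/negPn/negP => zs; have [_ zr] := side_exit ear exz xs zs.
    by rewrite zr eqxx in nzr.
  have [z exz dxz] := dist_descent conn nxr.
  by have /= := none z; rewrite exz dxz eqxx.
have -> : edges_in e S = [set [set x; par x] | x in side a r].
  apply/setP => A; rewrite inE; apply/idP/imsetP; last first.
    case=> x xs ->; have [exp _ pS] := parP _ xs.
    apply/exists_inP; exists x; first by rewrite in_setU1 xs orbT.
    by apply/exists_inP; exists (par x); rewrite ?exp ?eqxx.
  case/exists_inP=> x xS /exists_inP[y yS /andP[exy /eqP ->]].
  have key u v : u \in S -> e u v -> d u r = (d v r).+1 ->
      exists2 w, w \in side a r & [set u; v] = [set w; par w].
    rewrite in_setU1 => /orP[/eqP->|us euv duv]; first by rewrite distxx.
    exists u => //; have [eup dup _] := parP _ us.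
    have nur : u != r by apply: contraTneq us => ->; exact: sideN_root.
    congr [set u; _]; apply: (dist_descent_uniq nur) => //; lia.
  have [dxy|dyx] := dist_parity r exy; first exact: key.
  by rewrite setUC; apply: key; rewrite // sym.
apply: card_in_imset => x y xs ys /= eqs.
have [_ dx _] := parP _ xs; have [_ dy _] := parP _ ys.
have : x \in [set y; par y] by rewrite -eqs !inE eqxx.
have : y \in [set x; par x] by rewrite eqs !inE eqxx.
rewrite !inE => /orP[/eqP->//|/eqP yp] /orP[/eqP->//|/eqP xp].
by rewrite -yp in dx; rewrite -xp in dy; lia.
Qed.

Lemma edges_in_sub (S S' : {set V}) : S \subset S' -> edges_in e S \subset edges_in e S'.
Proof.
move=> /subsetP subS; apply/subsetP => A; rewrite !inE.
case/exists_inP=> x /subS xS /exists_inP[y /subS yS exy].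
by apply/exists_inP; exists x => //; apply/exists_inP; exists y.
Qed.

Lemma weight_ge a v : e v a -> #|side a v| <= weight e v.
Proof.
rewrite sym => eav; rewrite -card_edges_side //.
have [S /= mS subS] := maxset_exists (side_pendant eav).
apply: leq_trans (leq_bigmax_cond (F := fun S : {set V} => #|edges_in e S|) _ mS).
by apply: subset_leq_card; exact: edges_in_sub.
Qed.

Lemma weight_le v w : (forall a, e v a -> #|side a v| <= w) -> weight e v <= w.
Proof.
move=> lew; apply/bigmax_leqP => S /maxsetp/pendant_sub_side[a eva subS].
apply: leq_trans (lew a eva); rewrite -card_edges_side 1?sym //.
by apply: subset_leq_card; exact: edges_in_sub.
Qed.

(** The branches at [u] are [side c u] and parts of [side u c] without [u]. As [#|side u c|] is at
    most [weight c], which is below [weight u], the weight of [u] is at most [#|side c u|], and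
    [side c u] outnumbers its complement. *)
Lemma centroid_side c u : e c u -> c \in centroid e -> u \notin centroid e ->
  #|V| < #|side c u|.*2.
Proof.
move=> ecu; rewrite !inE => /forallP cmin; rewrite negb_forall => /existsP[v].
rewrite -ltnNge => ltv; have ltcu := leq_ltn_trans (cmin v) ltv.
have euc : e u c by rewrite sym.
have := weight_ge ecu; have := cardsC (side c u); rewrite (sideC ecu).
have : weight e u <= maxn #|side c u| #|side u c|.-1.
  apply: weight_le => a eua; have [->|nac] := eqVneq a c; first exact: leq_maxl.
  rewrite leq_max; apply/orP; right.
  have -> : #|side u c|.-1 = #|side u c :\ u|.
    by rewrite (cardsD1 u (side u c)) side_root.
  apply: subset_leq_card; apply/subsetP => x xa.
  by rewrite in_setD1 andbC (side_sub eua euc nac xa).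
lia.
Qed.

End TreeMetric.
(** * Dirichlet energy *)

Local Open Scope ring_scope.

Section Energy.
Variables (R : realFieldType) (V : finType) (e : rel V).
Hypothesis sym : symmetric e.
Implicit Types (f g h : V -> R) (S : {set V}).

Definition dot f g : R := \sum_x f x * g x.
Definition lap f x : R := \sum_(z | e x z) (f x - f z).
Definition energy f : R := dot f (lap f).

Lemma dotC f g : dot f g = dot g f.
Proof. by apply: eq_bigr => x _; rewrite mulrC. Qed.

Lemma eq_dot f f' g g' : f =1 f' -> g =1 g' -> dot f g = dot f' g'.
Proof. by move=> ff' gg'; apply: eq_bigr => x _; rewrite ff' gg'. Qed.

Lemma eq_lap f g : f =1 g -> lap f =1 lap g.
Proof. by move=> fg x; apply: eq_bigr => z _; rewrite !fg. Qed.

Lemma dotDl a b f g h :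
  dot (fun x => a * f x + b * g x) h = a * dot f h + b * dot g h.
Proof.
by rewrite /dot !big_distrr -big_split; apply: eq_bigr => x _ /=; ring.
Qed.

Lemma dotDr a b f g h :
  dot h (fun x => a * f x + b * g x) = a * dot h f + b * dot h g.
Proof. by rewrite dotC dotDl !(dotC h). Qed.

Lemma lapD a b f g x :
  lap (fun x => a * f x + b * g x) x = a * lap f x + b * lap g x.
Proof.
by rewrite /lap !big_distrr -big_split; apply: eq_bigr => z _ /=; ring.
Qed.

Lemma dot_lapE f g :
  dot f (lap g) *+ 2 = \sum_x \sum_(z | e x z) (f x - f z) * (g x - g z).
Proof.
have swap : dot f (lap g) = \sum_x \sum_(z | e x z) f z * (g z - g x).
  rewrite (exchange_big_dep predT) //; apply: eq_bigr => x _ /=.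
  by rewrite /lap big_distrr /=; apply: eq_bigl => z; rewrite sym.
rewrite mulr2n {2}swap /dot -big_split; apply: eq_bigr => x _ /=.
by rewrite /lap big_distrr -big_split /=; apply: eq_bigr => z _; ring.
Qed.

Lemma dot_lapC f g : dot f (lap g) = dot g (lap f).
Proof.
apply: (pmulrnI (ltn0Sn 1)); rewrite /= !dot_lapE.
by apply: eq_bigr => x _; apply: eq_bigr => z _; rewrite mulrC.
Qed.

Lemma dot_ge0 f : 0 <= dot f f.
Proof. by apply: sumr_ge0 => x _; rewrite -expr2 sqr_ge0. Qed.

Lemma dot_gt0 f x : f x != 0 -> 0 < dot f f.
Proof.
move=> fx; rewrite lt_def dot_ge0 andbT psumr_eq0 => [|y _]; last first.
  by rewrite -expr2 sqr_ge0.
by apply: contra fx => /allP/(_ x); rewrite mem_index_enum mulf_eq0 orbb; apply.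
Qed.

Lemma dot_gt0P f : 0 < dot f f -> exists x, f x != 0.
Proof.
move=> lt0; apply/existsP; apply: contraTT lt0; rewrite negb_exists.
move=> /forallP f0; rewrite -leNgt /dot big1 // => x _.
by have := f0 x; rewrite negbK => /eqP ->; rewrite mul0r.
Qed.

Lemma energy_ge0 f : 0 <= energy f.
Proof.
rewrite -(pmulrn_lge0 _ (ltn0Sn 1)) /= dot_lapE.
by apply: sumr_ge0 => x _; apply: sumr_ge0 => z _; rewrite -expr2 sqr_ge0.
Qed.

Lemma energy_abs f : energy (fun x => `|f x|) <= energy f.
Proof.
rewrite -(ler_pMn2r (ltn0Sn 1)) !dot_lapE.
apply: ler_sum => x _; apply: ler_sum => z _; rewrite -!expr2.
rewrite -[X in _ <= X]real_normK ?num_real //.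
rewrite -[X in X <= _]real_normK ?num_real //.
by rewrite ler_pXn2r ?nnegrE ?normr_ge0 // ler_dist_dist.
Qed.

Lemma dot_abs f : dot (fun x => `|f x|) (fun x => `|f x|) = dot f f.
Proof. by apply: eq_bigr => x _; rewrite -expr2 real_normK ?num_real. Qed.

Lemma discriminant_le (a b c : R) : 0 <= c ->
  (forall t, 0 <= a + 2 * b * t + c * t ^+ 2) -> b ^+ 2 <= a * c.
Proof.
move=> c0 quad; have [c_eq0|cn0] := eqVneq c 0.
  have [->|bn0] := eqVneq b 0; first by rewrite c_eq0 mulr0 expr0n.
  (* This argument gives the polynomial the value -1. *)
  have := quad (- (a + 1) / (2 * b)); rewrite c_eq0 mul0r addr0.
  by rewrite mulrC divfK ?mulf_neq0 ?pnatr_eq0 //; lra.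
have lt0c : 0 < c by rewrite lt_def cn0.
have := quad (- b / c); rewrite -(pmulr_rge0 _ lt0c).
suff -> : c * (a + 2 * b * (- b / c) + c * (- b / c) ^+ 2) = a * c - b ^+ 2.
  by rewrite subr_ge0.
by field.
Qed.

Lemma dot_cauchy f g : dot f g ^+ 2 <= dot f f * dot g g.
Proof.
apply: discriminant_le (dot_ge0 g) _ => t.
have := dot_ge0 (fun x => 1 * f x + t * g x).
by rewrite dotDl !dotDr (dotC g f); lra.
Qed.

Lemma energyD a b f g : energy (fun x => a * f x + b * g x) =
  a ^+ 2 * energy f + 2 * a * b * dot f (lap g) + b ^+ 2 * energy g.
Proof.
rewrite /energy (eq_dot (frefl _) (lapD a b f g)) dotDl !dotDr (dot_lapC g f).
by ring.
Qed.

Lemma energy_cauchy f g : dot f (lap g) ^+ 2 <= energy f * energy g.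
Proof.
apply: discriminant_le (energy_ge0 g) _ => t.
have := energy_ge0 (fun x => 1 * f x + t * g x); rewrite energyD.
by lra.
Qed.

Definition supported S f := forall x, x \notin S -> f x = 0.

Section SeparatedSupports.
Variable mu : R.
Hypothesis rayleigh : forall f, \sum_x f x = 0 -> mu * dot f f <= energy f.

(* A combination of |f| and |g| orthogonal to the constants contradicts the
   Rayleigh bound. *)
Lemma rayleigh_separated S1 S2 f g :
    (forall x y, x \in S1 -> y \in S2 -> (x != y) && ~~ e x y) ->
    supported S1 f -> supported S2 g -> 0 < dot g g ->
    energy g <= mu * dot g g ->
  mu * dot f f <= energy f.
Proof.
move=> sep supf supg g_gt0 Eg; rewrite leNgt; apply/negP => Ef.
pose af x := `|f x|; pose ag x := `|g x|.
have zero x y : af x != 0 -> ag y != 0 -> (x != y) && ~~ e x y.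
  rewrite !normr_eq0 => fx gy; apply: sep.
    by apply: contraNT fx => /supf ->.
  by apply: contraNT gy => /supg ->.
pose s := \sum_x af x; pose t := \sum_x ag x.
have t_gt0 : 0 < t.
  have [x gx] := dot_gt0P g_gt0; rewrite /t (bigD1 x) //=.
  by rewrite ltr_pwDl ?normr_gt0 // sumr_ge0 // => y _; exact: normr_ge0.
have dot0 : dot af ag = 0.
  apply: big1 => x _; apply/eqP; rewrite mulf_eq0; apply/norP.
  by case=> fx gx; have := zero x x fx gx; rewrite eqxx.
have lap0 : dot af (lap ag) = 0.
  apply: big1 => x _; have [->|fx] := eqVneq (af x) 0; first by rewrite mul0r.
  rewrite /lap big1 ?mulr0 // => z exz.
  have agz y : (x == y) || e x y -> ag y = 0.
    move=> xy; apply/eqP/negPn/negP => gy; have := zero x y fx gy.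
    by case: (x == y) xy => //= ->.
  by rewrite !agz ?exz ?eqxx ?orbT // subrr.
have sum0 : \sum_x (t * af x + (- s) * ag x) = 0.
  by rewrite big_split /= -!big_distrr /= -/s -/t mulNr mulrC subrr.
have := rayleigh sum0; rewrite energyD dotDl !dotDr (dotC ag af) dot0 lap0 !dot_abs.
have Eaf := energy_abs f; have Eag := energy_abs g.
have lt1 : t ^+ 2 * energy af < t ^+ 2 * (mu * dot f f).
  by rewrite ltr_pM2l ?exprn_gt0 //; exact: le_lt_trans Ef.
have le2 : s ^+ 2 * energy ag <= s ^+ 2 * (mu * dot g g).
  by rewrite ler_wpM2l ?sqr_ge0 //; exact: le_trans Eg.
by apply/negP; rewrite -ltNge sqrrN; lra.
Qed.

End SeparatedSupports.

Section NodalBranch.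
Variables (mu : R) (Y : V -> R) (r : V) (S : {set V}).
Hypothesis lapY : forall x, lap Y x = mu * Y x.
Hypothesis S_nbr : forall x z, x \in S -> e x z -> (z \in S) || (z == r).
Hypothesis S_min : forall f, supported S f -> mu * dot f f <= energy f.

(* The negative part of Y on S is a minimiser of the Rayleigh quotient. *)
Lemma nodal_branch_pos : 0 <= Y r -> forall x z, x \in S -> e x z ->
  0 <= Y x * Y z /\ (Y x = 0 -> Y z = 0).
Proof.
move=> Yr0.
(* [f] is the negative part of [Y] on [S], while [P] is the positive part there and [Y] elsewhere;
   their pointwise product vanishes. *)
pose f x := if x \in S then Num.max 0 (- Y x) else 0.
pose P x := Y x + f x.
have supf : supported S f by move=> x /negbTE; rewrite /f => ->.
have f_ge0 x : 0 <= f x by rewrite /f; case: ifP => //; rewrite le_max lexx.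
have P_ge0 x : (x \in S) || (x == r) -> 0 <= P x.
  rewrite /P /f; case: ifP => /= [_ _|_ /eqP ->]; last by rewrite addr0.
  by have [] := leP 0 (- Y x); lra.
have fP x : f x * P x = 0.
  rewrite /P /f; case: ifP => _; last by rewrite mul0r.
  by have [] := leP 0 (- Y x) => _; rewrite ?mul0r // subrr mulr0.
have fPz x z : e x z -> 0 <= f x * P z.
  move=> exz; have [xS|/supf ->] := boolP (x \in S); last by rewrite mul0r.
  by rewrite mulr_ge0 // P_ge0 // (S_nbr xS exz).
have lapP : dot f (lap P) = - \sum_x \sum_(z | e x z) f x * P z.
  rewrite -sumrN; apply: eq_bigr => x _; rewrite /lap big_distrr -sumrN /=.
  by apply: eq_bigr => z _; rewrite mulrBr fP sub0r.
have fY : dot f Y = - dot f f.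
  rewrite -sumrN; apply: eq_bigr => x _.
  by have /eqP := fP x; rewrite /P mulrDr addr_eq0 => /eqP.
(* [S_min] makes this nonnegative, while [lapP] shows it to be minus a sum of nonnegative terms. So
   every product [f x * P z] along an edge is zero, and [f] is a minimiser. *)
have EP : dot f (lap P) = energy f - mu * dot f f.
  transitivity (dot f (fun x => mu * Y x + 1 * lap f x)).
    apply: eq_dot => // x; rewrite -lapY mul1r -[lap Y x]mul1r -[lap f x]mul1r.
    by rewrite -lapD; apply: eq_lap => y; rewrite !mul1r.
  by rewrite dotDr fY mul1r mulrN addrC.
have sum_ge0 x : 0 <= \sum_(z | e x z) f x * P z.
  by apply: sumr_ge0 => z; exact: fPz.
have sum0 : \sum_x \sum_(z | e x z) f x * P z = 0.
  apply/eqP; rewrite eq_le sumr_ge0 // andbT -oppr_ge0 -lapP EP subr_ge0.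
  exact: S_min.
have fPz0 x z : e x z -> f x * P z = 0.
  move=> exz; have /eqP := sum0; rewrite psumr_eq0 // => /allP/(_ x).
  rewrite mem_index_enum => /(_ isT); rewrite psumr_eq0 => [|y]; last exact: fPz.
  by move/allP/(_ z); rewrite mem_index_enum exz => /(_ isT)/eqP.
have Ef : energy f = mu * dot f f.
  by apply/eqP; rewrite -subr_eq0 -EP lapP sum0 oppr0.
move=> x z xS exz; have zS := S_nbr xS exz.
have Pf y : (y \in S) || (y == r) -> Y y = P y - f y by rewrite /P addrK.
have P_f y : (y \in S) || (y == r) -> 0 <= P y by exact: P_ge0.
split.
  rewrite (Pf x) ?xS // (Pf z) // mulrBl !mulrBr.
  have := fPz0 x z exz; have := fPz0 z x; rewrite sym => /(_ exz).
  rewrite [P x * f z]mulrC => -> ->; rewrite subr0 sub0r opprK.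
  by rewrite addr_ge0 // mulr_ge0 // P_f // xS.
move=> Yx0; have fx0 : f x = 0.
  by have /eqP := fP x; rewrite /P Yx0 add0r -expr2 sqrf_eq0 => /eqP.
pose delta y : R := (y == x)%:R.
have dotdelta g : dot delta g = g x.
  rewrite /dot (bigD1 x) //= /delta eqxx mul1r big1 ?addr0 // => y /negbTE ->.
  by rewrite mul0r.
(* First variation: moving the minimiser [f] by [t] at [x] cannot violate [S_min]. The term [|mu|]
   bounds [- mu] and keeps the leading coefficient nonnegative. *)
have lapf0 : lap f x = 0.
  apply/eqP; rewrite -sqrf_eq0 eq_le sqr_ge0 andbT.
  rewrite -(mul0r (energy delta + `|mu|)).
  apply: discriminant_le; first by rewrite addr_ge0 ?energy_ge0.
  move=> t; rewrite add0r.
  have := @S_min (fun y => 1 * f y + t * delta y).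
  rewrite energyD dotDl !dotDr (dotC f) !dotdelta fx0 dot_lapC dotdelta Ef.
  rewrite {1 2}/delta eqxx => /(_ _)/wrap[y yS|].
    rewrite supf // /delta; have [yx|_] := eqVneq y x; last by rewrite !mulr0 addr0.
    by rewrite yx xS in yS.
  have : 0 <= t ^+ 2 * (`|mu| + mu).
    by rewrite mulr_ge0 ?sqr_ge0 // addrC -lerBlDl sub0r -normrN ler_norm.
  by rewrite -[true%:R]/(1 : R); lra.
(* A nonnegative function vanishing at [x] together with its Laplacian vanishes at the neighbours of
   [x]. This applies first to [f], which makes [Y] nonnegative there, and then to [Y]. *)
have f_nbr y : e x y -> f y = 0.
  move=> exy; have /eqP := lapf0; rewrite /lap fx0.
  rewrite (eq_bigr (fun z => - f z)) => [|w _]; last by rewrite sub0r.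
  rewrite sumrN oppr_eq0 psumr_eq0 // => /allP/(_ y).
  by rewrite mem_index_enum exy => /(_ isT)/eqP.
have Y_nbr y : e x y -> 0 <= Y y.
  move=> exy; have yS := S_nbr xS exy.
  by rewrite Pf // f_nbr // subr0 P_ge0.
have /eqP := lapY x; rewrite Yx0 mulr0 /lap Yx0.
rewrite (eq_bigr (fun z => - Y z)) => [|w _]; last by rewrite sub0r.
rewrite sumrN oppr_eq0 psumr_eq0 // => /allP/(_ z).
by rewrite mem_index_enum exz => /(_ isT)/eqP.
Qed.

End NodalBranch.

(** The conclusion excludes characteristic vertices and edges meeting [S]. Since [- Y] satisfies the
    same hypotheses, the sign of [Y r] can be chosen. *)
Lemma nodal_branch mu Y r S : (forall x, lap Y x = mu * Y x) ->
    (forall x z, x \in S -> e x z -> (z \in S) || (z == r)) ->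
    (forall f, supported S f -> mu * dot f f <= energy f) ->
  forall x z, x \in S -> e x z -> 0 <= Y x * Y z /\ (Y x = 0 -> Y z = 0).
Proof.
move=> lapY Snbr Smin x z xS exz.
have [Yr|Yr] := leP 0 (Y r); first exact: nodal_branch_pos Smin Yr x z xS exz.
have [||] := nodal_branch_pos (Y := fun x => - Y x) _ Snbr Smin _ xS exz.
- move=> y; rewrite mulrN -lapY /lap -sumrN; apply: eq_bigr => w _.
  by rewrite opprB opprK addrC.
- by rewrite oppr_ge0 ltW.
- rewrite mulrNN => -> impl; split=> // Yx0.
  by apply/eqP; rewrite -oppr_eq0 impl // Yx0 oppr0.
Qed.

(* As Y r = 0, cutting Y off outside S leaves lap Y unchanged on S. *)
Lemma energy_restrict mu Y r S : (forall x, lap Y x = mu * Y x) -> Y r = 0 ->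
    (forall x z, x \in S -> e x z -> (z \in S) || (z == r)) ->
  let f x := if x \in S then Y x else 0 in energy f = mu * dot f f.
Proof.
move=> lapY Yr0 Snbr f; rewrite /energy /dot big_distrr; apply: eq_bigr => x _ /=.
rewrite /f; case: ifP => xS; last by rewrite !mul0r mulr0.
rewrite mulrCA -lapY; congr (_ * _); apply: eq_bigr => z exz; rewrite xS.
case: ifP => // zS; congr (_ - _).
by have := Snbr x z xS exz; rewrite zS => /eqP ->.
Qed.

End Energy.

(** * The Green kernel of a branch *)

Section GreenKernel.
Variables (V : finType) (e : rel V).
Hypothesis tree : is_tree e.
Let conn := tree_conn tree.
Let sym := tree_sym tree.
Local Notation d := (dist e).

(* Twice the number of edges shared by the paths from x and from y to r; half of
   it is the Green kernel of the Laplacian with Dirichlet condition at r. *)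
Definition common r x y : nat := (d r x + d r y - d x y)%N.

Lemma commonC r x y : common r x y = common r y x.
Proof. by rewrite /common addnC (distC conn sym x). Qed.

Lemma common_root r y : common r r y = 0%N.
Proof. by rewrite /common distxx subnn. Qed.

Lemma common_separated r x y : d x y = (d r x + d r y)%N -> common r x y = 0%N.
Proof. by rewrite /common => ->; exact: subnn. Qed.

Lemma common_le r x y : (common r x y <= (minn (d r x) (d r y)).*2)%N.
Proof.
rewrite /common; have := dist_triangle conn r x y; have := dist_triangle conn r y x.
by rewrite (distC conn sym y x); lia.
Qed.

Variable R : realFieldType.

(** For [x] other than [y], exactly one neighbour of [x] is closer to [y] and contributes 1, every
    other one -1; at [x = y] all contribute -1. *)
Lemma lap_dist x y : lap e (fun z => (d z y)%:R : R) x =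
  if x == y then - (degree e x)%:R else 2 - (degree e x)%:R.
Proof.
have cardE : \sum_(z | e x z) 1 = (degree e x)%:R :> R.
  by rewrite sumr_const; congr (_ *+ _); apply: eq_card => z; rewrite inE.
have step z : e x z -> (d x y)%:R - (d z y)%:R =
    (if (d z y < d x y)%N then 1 else -1) :> R.
  move=> exz; have [->|->] := dist_parity tree y exz.
    by rewrite leqnn -natr1; lra.
  by rewrite ltnNge leqnSn -natr1 /=; lra.
rewrite /lap (eq_bigr _ step) -cardE -sumrN; have [xy|nxy] := eqVneq x y.
  by apply: eq_bigr => z _; rewrite xy distxx.
have [a exa dxa] := dist_descent conn nxy.
rewrite !(bigD1 a exa) /= dxa leqnn.
rewrite (eq_bigr (fun=> -1)) => [|z /andP[exz nza]]; first by ring.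
case: ifP => // ltz; case/eqP: nza.
by apply: (dist_descent_uniq tree nxy) => //; lia.
Qed.

(** The degrees in the Laplacians of the distances to [r] and to [y] cancel, leaving a point mass at
    [y] away from [r]. *)
Lemma lap_common r x y : x != r ->
  lap e (fun z => (common r z y)%:R : R) x = 2 * (x == y)%:R.
Proof.
move=> nxr; have -> : lap e (fun z => (common r z y)%:R : R) x =
    lap e (fun z => (d z r)%:R : R) x - lap e (fun z => (d z y)%:R : R) x.
  rewrite /lap -sumrB; apply: eq_bigr => z _; rewrite /common.
  have tri w : (d w y <= d r w + d r y)%N.
    by rewrite (distC conn sym r w); exact: dist_triangle.
  by rewrite !natrB ?tri // !natrD !(distC conn sym r); ring.
rewrite !lap_dist (negbTE nxr); case: eqP => _; rewrite /=; ring.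
Qed.

End GreenKernel.

Lemma lap_sum (R : realFieldType) (V I : finType) (e : rel V) (c : I -> R)
    (F : I -> V -> R) x :
  lap e (fun z => \sum_i F i z * c i) x = \sum_i lap e (F i) x * c i.
Proof.
under [RHS]eq_bigr => i _ do rewrite /lap big_distrl.
rewrite exchange_big /=; apply: eq_bigr => z _.
by rewrite -sumrB; apply: eq_bigr => i _; rewrite mulrBl.
Qed.

(* Where the kernel of T2 dominates that of T1, the least Dirichlet eigenvalue of
   B2 is at most that of B1: h is the potential of the transported charge f. *)
Section Transfer.
Variables (R : realFieldType) (V1 V2 : finType) (e1 : rel V1) (e2 : rel V2).
Hypotheses (tree1 : is_tree e1) (tree2 : is_tree e2).
Variables (r1 : V1) (r2 : V2) (B1 : {set V1}) (B2 : {set V2}) (phi : V1 -> V2).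
Hypothesis B1_root : r1 \notin B1.
Hypothesis B2_root : r2 \notin B2.
Hypothesis B2_sep : forall x y, x \notin B2 -> y \in B2 -> common e2 r2 x y = 0%N.
Hypothesis phi_in : forall x, x \in B1 -> phi x \in B2.
Hypothesis phi_inj : {in B1 &, injective phi}.
Hypothesis dominated : forall x y, x \in B1 -> y \in B1 ->
  (common e1 r1 x y <= common e2 r2 (phi x) (phi y))%N.

Lemma energy_transfer (f : V1 -> R) : supported B1 f -> 0 < dot f f ->
  exists h : V2 -> R, [/\ supported B2 h, 0 < dot h h &
    energy e2 h * dot f f <= energy e1 f * dot h h].
Proof.
move=> supf f_gt0.
pose f' x := `|f x|; have f'0 x : x \notin B1 -> f' x = 0.
  by move=> /supf; rewrite /f' => ->; rewrite normr0.
pose K1 x y : R := (common e1 r1 x y)%:R; pose K2 x y : R := (common e2 r2 x y)%:R.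
(* [g] is the potential on the first tree of the charge [2 * f'], and [h] that of its image under
   [phi] on the second. The absolute values in [f'] let the entrywise domination of the kernels be
   summed. *)
pose g x := \sum_y K1 x y * f' y; pose h x := \sum_y K2 x (phi y) * f' y.
have lapg x : x != r1 -> lap e1 g x = 2 * f' x.
  move=> nx; rewrite /g (lap_sum e1 f' (fun y x => K1 x y)).
  rewrite (bigD1 x) //= /K1 lap_common // eqxx mulr1 big1 ?addr0 // => y nyx.
  by rewrite lap_common // eq_sym (negbTE nyx) mulr0 mul0r.
have laph x : x != r2 -> lap e2 h x = 2 * \sum_y (x == phi y)%:R * f' y.
  move=> nx; rewrite /h (lap_sum e2 f' (fun y x => K2 x (phi y))) big_distrr.
  by apply: eq_bigr => y _; rewrite /K2 lap_common //= mulrA.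
have h0 x : x \notin B2 -> h x = 0.
  move=> xB; apply: big1 => y _; have [yB|/f'0 ->] := boolP (y \in B1).
    by rewrite /K2 B2_sep ?phi_in // mul0r.
  by rewrite mulr0.
have g0 : g r1 = 0.
  by apply: big1 => y _; rewrite /K1 common_root mul0r.
pose ff := dot f f; have ff' : dot f' f' = ff by exact: dot_abs.
have Efg : dot f' (lap e1 g) = 2 * ff.
  rewrite -ff' /dot big_distrr; apply: eq_bigr => x _ /=.
  have [->|/lapg ->] := eqVneq x r1; first by rewrite f'0 // !mul0r mulr0.
  by rewrite mulrCA.
have Eg : energy e1 g = 2 * dot g f'.
  rewrite /energy /dot big_distrr; apply: eq_bigr => x _ /=.
  have [->|/lapg ->] := eqVneq x r1; first by rewrite g0 !mul0r mulr0.
  by rewrite mulrCA.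
pose hf := dot (h \o phi) f'.
have Eh : energy e2 h = 2 * hf.
  have -> : energy e2 h = \sum_x h x * (2 * \sum_y (x == phi y)%:R * f' y).
    apply: eq_bigr => x _; have [->|/laph -> //] := eqVneq x r2.
    by rewrite h0 // !mul0r.
  under eq_bigr => x _ do rewrite mulrCA big_distrr.
  rewrite -big_distrr exchange_big /=; congr (_ * _); apply: eq_bigr => y _.
  rewrite (bigD1 (phi y)) //= eqxx mul1r big1 ?addr0 // => x /negbTE ->.
  by rewrite mul0r mulr0.
have gh : dot g f' <= hf.
  apply: ler_sum => x _; have [xB|/f'0 ->] := boolP (x \in B1); last by rewrite !mulr0.
  rewrite ler_wpM2r ?normr_ge0 //; apply: ler_sum => y _.
  have [yB|/f'0 ->] := boolP (y \in B1); last by rewrite !mulr0.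
  by rewrite ler_wpM2r ?normr_ge0 // ler_nat dominated.
pose hh := dot h h.
have hf_le : hf ^+ 2 <= hh * ff.
  have -> : hf = dot (fun x => if x \in B1 then h (phi x) else 0) f'.
    apply: eq_bigr => x _ /=; case: ifPn => // /f'0 ->.
    by rewrite !mulr0.
  apply: le_trans (dot_cauchy _ _) _; rewrite ff' ler_wpM2r ?dot_ge0 //.
  rewrite /dot (bigID (mem B1)) /= [X in _ + X]big1 ?addr0 => [|x /negbTE ->]; last first.
    by rewrite mul0r.
  under eq_bigr => x -> do [].
  rewrite -(big_imset (fun z => h z * h z) phi_inj) /= /hh /dot.
  rewrite [X in _ <= X](bigID (mem (phi @: B1))) /= lerDl.
  by apply: sumr_ge0 => z _; rewrite -expr2 sqr_ge0.
(* Cauchy-Schwarz for the energy and the domination give [2 * ff ^+ 2 <= energy e1 f * hf]; combined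
   with [hf ^+ 2 <= hh * ff], this bounds [2 * hf], which is the energy of [h]. *)
have cs := energy_cauchy (tree_sym tree1) f' g.
have Ef := energy_abs (tree_sym tree1) f; rewrite -/f' in Ef.
have E1_ge0 := energy_ge0 (tree_sym tree1) f'.
have ff_gt0 : 0 < ff by [].
rewrite Efg Eg in cs.
have cs2 : 2 * ff ^+ 2 <= energy e1 f * hf.
  have : energy e1 f' * dot g f' <= energy e1 f * hf.
    apply: ler_pM => //; rewrite -(pmulr_rge0 _ (ltr0n R 2)) -Eg.
    exact: energy_ge0 (tree_sym tree1) _.
  by move: cs; rewrite exprMn; lra.
have hf_gt0 : 0 < hf.
  rewrite lt_neqAle eq_sym; apply/andP; split; last first.
    rewrite -(pmulr_rge0 _ (ltr0n R 2)) -Eh; exact: energy_ge0 (tree_sym tree2) _.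
  apply: contraTneq cs2 => ->; rewrite mulr0 -ltNge mulr_gt0 ?exprn_gt0 ?ltr0n //.
have hh_gt0 : 0 < hh.
  rewrite -(pmulr_lgt0 _ ff_gt0); apply: lt_le_trans hf_le; exact: exprn_gt0.
exists h; split=> //; rewrite -/ff -/hh Eh.
have E0 : 0 <= energy e1 f by exact: energy_ge0 (tree_sym tree1) _.
have : 2 * ff ^+ 2 * hf <= energy e1 f * (hh * ff).
  apply: le_trans (_ : energy e1 f * hf ^+ 2 <= _); last by rewrite ler_wpM2l.
  by rewrite [hf ^+ 2]expr2 mulrA ler_wpM2r // ltW.
by move=> le; rewrite -(ler_pM2r ff_gt0); lra.
Qed.

End Transfer.
(** * The second smallest eigenvalue *)

Section SymmetricSpectrum.
Local Open Scope complex_scope.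
Local Open Scope sesquilinear_scope.
Variables (R : rcfType) (n : nat) (A : 'M[R]_n) (s : seq R).
Hypothesis symA : A^T = A.
Hypothesis psdA : forall v : 'rV_n, 0 <= (v *m A *m v^T) 0 0.
Hypothesis charA : char_poly A = \prod_(a <- s) ('X - a%:P).

Local Notation toC := (real_complex R).
Local Notation cplx M := (map_mx toC M).

Let P := spectralmx (cplx A).
Let D := spectral_diag (cplx A).

Lemma conj_real_mx m p (M : 'M[R]_(m, p)) : map_mx Num.Def.conjC (cplx M) = (cplx M).
Proof. by apply/matrixP => i j; rewrite !mxE; exact: conjc_real. Qed.

Lemma spectral_real_sym : P *m (cplx A) = diag_mx D *m P.
Proof.
have /hermitian_normalmx/orthomx_spectralP -> : (cplx A) \is hermsymmx.
  by apply/is_hermitianmxP; rewrite expr0 scale1r map_trmx symA conj_real_mx.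
by rewrite -/P -/D !mulmxA mulmxV ?mul1mx // spectral_unit.
Qed.

(** As [P] intertwines the two matrices, their characteristic polynomials agree after multiplication
    by the nonzero [\det P]. So the complex eigenvalues are the reals listed in [s], with
    multiplicity. *)
Lemma perm_spectral_diag :
  perm_eq [seq D 0 i | i <- index_enum 'I_n] [seq toC a | a <- s].
Proof.
apply: prod_XsubC_eq; rewrite [LHS]big_map [RHS]big_map.
have := map_char_poly toC A; rewrite charA rmorph_prod /=.
rewrite (eq_bigr (fun a => 'X - (toC a)%:P)); last first.
  by move=> a _; rewrite rmorphB /= map_polyX map_polyC.
move=> ->; have <- : char_poly (diag_mx D) = \prod_i ('X - (D 0 i)%:P).
  rewrite char_poly_trig ?diag_mx_is_trig //.
  by apply: eq_bigr => i _; rewrite mxE eqxx.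
pose Q : 'M[{poly R[i]}]_n := map_mx polyC P.
have detQ : \det Q != 0.
  rewrite det_map_mx polyC_eq0 -unitfE -unitmxE; exact: spectral_unit.
apply: (mulfI detQ); rewrite [LHS]mulrC /char_poly -!det_mulmx; congr (\det _).
rewrite /char_poly_mx mulmxBr mulmxBl -!map_mxM -spectral_real_sym; congr (_ - _).
by rewrite scalar_mxC.
Qed.

Let l i := complex.Re (D 0 i).

Lemma spectral_diag_real i : D 0 i = toC (l i).
Proof.
have : D 0 i \in [seq toC a | a <- s].
  by rewrite -(perm_mem perm_spectral_diag) map_f // mem_index_enum.
by rewrite /l => /mapP[a _ ->].
Qed.

Lemma perm_eigenvalues : perm_eq [seq l i | i <- index_enum 'I_n] s.
Proof.
apply: (perm_map_inj (@complexI R)); rewrite -map_comp.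
apply: perm_trans perm_spectral_diag.
by rewrite (eq_map (g := fun i => D 0 i)) // => i /=; rewrite -spectral_diag_real.
Qed.

Lemma eigenvalues_ge0 a : a \in s -> 0 <= a.
Proof.
move=> as_; have : eigenvalue A a.
  by rewrite eigenvalue_root_char charA root_prod_XsubC.
case/eigenvalueP=> v vA nv0; have := psdA v.
rewrite vA -scalemxAl mxE; rewrite pmulr_lge0 // mxE.
have [j vj] : exists j, v 0 j != 0.
  apply/existsP; apply: contraNT nv0; rewrite negb_exists => /forallP v0.
  by apply/eqP/rowP => j; rewrite mxE; apply/eqP; rewrite -[_ == _]negbK.
apply: lt_le_trans (_ : v 0 j ^+ 2 <= _); first by rewrite exprn_even_gt0.
rewrite (bigD1 j) //= mxE -expr2 lerDl; apply: sumr_ge0 => k _.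
by rewrite mxE -expr2 sqr_ge0.
Qed.

Lemma count_eigenvalues (p : pred R) : count p s = #|[pred i | p (l i)]|.
Proof. by rewrite -(permP perm_eigenvalues) count_map -sum1_count sum1_card. Qed.

Lemma mul_adjoint_spectral : P *m P^t* = 1%:M.
Proof. exact/unitarymxP/spectral_unitarymx. Qed.

Lemma adjoint_mul_spectral : P^t* *m P = 1%:M.
Proof. exact: mulmx1C mul_adjoint_spectral. Qed.

(** Coordinates in the orthonormal eigenbasis formed by the rows of [P]. *)
Let coord (v : 'rV[R]_n) : 'rV[R[i]]_n := cplx v *m P^t*.

Lemma coord_dot v w : \sum_i coord v 0 i * (coord w 0 i)^* = toC ((v *m w^T) 0 0).
Proof.
transitivity ((coord v *m (coord w)^t*) 0 0).
  by rewrite mxE; apply: eq_bigr => i _; rewrite !mxE.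
rewrite /coord trmx_mul map_mxM trmxCK mulmxA -(mulmxA (cplx v)).
rewrite adjoint_mul_spectral mulmx1.
by rewrite map_trmx conj_real_mx -map_mxM mxE.
Qed.

Lemma coord_mul v i : coord (v *m A) 0 i = coord v 0 i * D 0 i.
Proof.
have PA : cplx A *m P^t* = P^t* *m diag_mx D.
  rewrite -[LHS]mul1mx -adjoint_mul_spectral -!mulmxA; congr (_ *m _).
  by rewrite mulmxA spectral_real_sym -mulmxA mul_adjoint_spectral mulmx1.
by rewrite /coord map_mxM -mulmxA PA mulmxA mul_mx_diag mxE.
Qed.

Hypothesis sorted_s : sorted <=%R s.
Hypothesis size_s : (1 < size s)%N.
Local Notation mu := s`_1.
Variable u : 'rV[R]_n.
Hypothesis uA : u *m A = 0.
Hypothesis kerA : forall v : 'rV[R]_n, v *m A = 0 -> (v <= u)%MS.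

Lemma count_lt_second : (count (fun a => (a < mu)%R) s <= 1)%N.
Proof.
case: s sorted_s size_s => [|a [|b t]] //= /andP[_]; rewrite ltxx add0n.
move=> /(order_path_min le_trans)/allP leb _; rewrite -[1%N]addn0 leq_add ?leq_b1 //.
rewrite leqNgt -has_count; apply/hasPn => c ct.
by rewrite -leNgt leb.
Qed.

Lemma row_spectral i : row i P *m cplx A = D 0 i *: row i P.
Proof. by rewrite -row_mul spectral_real_sym row_mul row_diag_mx -scalemxAl -rowE. Qed.

Lemma row_spectral_ker i : l i = 0 -> exists a, row i P = a *: cplx u.
Proof.
move=> li0; apply/sub_rVP; apply: submx_trans (_ : (row i P <= kermx (cplx A))%MS) _.
  by apply/sub_kermxP; rewrite row_spectral spectral_diag_real li0 scale0r.
rewrite -map_kermx map_submx; apply/row_subP => k; apply: kerA.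
by rewrite -row_mul mulmx_ker row0.
Qed.

(** If [mu] were 0, then 0 would occur twice in the sorted nonnegative list [s], and two rows of the
    invertible [P] would be multiples of [u]. *)
Lemma second_eigenvalue_gt0 : 0 < mu.
Proof.
rewrite lt_def eigenvalues_ge0 ?mem_nth // andbT; apply/negP => /eqP mu0.
have : (1 < count (pred1 0%R) s)%N.
  have ge0 := eigenvalues_ge0; case: s sorted_s size_s mu0 ge0 => [|a [|b t]] //=.
  move=> /andP[leab _] _ b0 /(_ a (mem_head _ _)) a0.
  by rewrite b0 in leab *; rewrite eqxx (@le_anti _ _ a 0) ?eqxx // leab.
rewrite count_eigenvalues => /card_gt1P[i [j [/eqP li /eqP lj nij]]].
have [a ia] := row_spectral_ker li; have [b jb] := row_spectral_ker lj.
have Pinj (w : 'rV_n) : w *m P = 0 -> w = 0.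
  by move=> w0; rewrite -[w](mulmxK (spectral_unit (cplx A))) -/P w0 mul0mx.
have eqij : b *: delta_mx 0 i - a *: delta_mx 0 j = 0 :> 'rV[R[i]]_n.
  apply: Pinj; rewrite mulmxBl -!scalemxAl -!rowE ia jb !scalerA mulrC.
  exact: subrr.
have /rowP/(_ i) := eqij; rewrite !mxE !eqxx (negbTE nij) mulr1 mulr0 subr0 => b0.
rewrite b0 scale0r rowE in jb; have /rowP/(_ j) := Pinj _ jb.
by rewrite !mxE !eqxx => /eqP; rewrite oner_eq0.
Qed.

(** The coordinates of [u] live where the eigenvalue is 0, and only one index has an eigenvalue
    below [mu]. So [v], orthogonal to [u], has coordinate 0 at that index, and elsewhere the
    eigenvalues are at least [mu]. *)
Lemma second_eigenvalue_rayleigh (v : 'rV[R]_n) : u != 0 -> (v *m u^T) 0 0 = 0 ->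
  mu * (v *m v^T) 0 0 <= (v *m A *m v^T) 0 0.
Proof.
move=> nu0 vu0; rewrite -lecR rmorphM /= -!coord_dot big_distrr /=.
have [i0 ui0] : exists i, coord u 0 i != 0.
  apply/existsP; apply: contraNT nu0; rewrite negb_exists => /forallP u0.
  have : coord u *m P = 0.
    rewrite (_ : coord u = 0) ?mul0mx //; apply/rowP => k; rewrite [RHS]mxE.
    by apply/eqP; rewrite -[_ == _]negbK.
  rewrite /coord -mulmxA adjoint_mul_spectral mulmx1 => /eqP.
  by rewrite map_mx_eq0.
have l0 i : coord u 0 i != 0 -> l i = 0.
  have : coord (u *m A) 0 i = 0 by rewrite uA /coord map_mx0 mul0mx mxE.
  rewrite coord_mul => /eqP; rewrite mulf_eq0 spectral_diag_real => /orP[->//|].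
  by rewrite fmorph_eq0 => /eqP.
have small i : l i < mu -> i = i0.
  move=> lti; apply/eqP/negPn/negP => nii; have := count_lt_second.
  rewrite count_eigenvalues leqNgt => /negP; apply; apply/card_gt1P.
  by exists i, i0; split; rewrite ?inE // l0 // second_eigenvalue_gt0.
have v0 : coord v 0 i0 = 0.
  have := coord_dot v u; rewrite vu0 rmorph0 (bigD1 i0) //= big1 ?addr0.
    move/eqP; rewrite mulf_eq0 => /orP[/eqP //|].
    by rewrite conjC_eq0 (negbTE ui0).
  move=> i nii; have [->|ui] := eqVneq (coord u 0 i) 0; first by rewrite rmorph0 mulr0.
  by rewrite (small i) ?eqxx // ?l0 ?second_eigenvalue_gt0 // in nii.
apply: ler_sum => i _; rewrite coord_mul spectral_diag_real mulrAC [X in _ <= X]mulrC.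
have [/small ->|gei] := ltP (l i) mu; first by rewrite v0 mul0r !mulr0.
by rewrite ler_wpM2r ?mul_conjC_ge0 // lecR.
Qed.

End SymmetricSpectrum.

(** * The Laplacian matrix and its characteristic sets *)

Section LaplacianMatrix.
Variables (R : realType) (V : finType) (e : rel V).
Hypothesis tree : is_tree e.
Implicit Types (f g : V -> R).

Definition row_of f : 'rV[R]_#|V| := \row_i f (enum_val i).

Lemma sum_enum_val f : \sum_(i < #|V|) f (enum_val i) = \sum_x f x.
Proof. by rewrite -[LHS](big_enum_val (A := V)); apply: eq_bigl => x; rewrite inE. Qed.

Lemma row_of_dot f g : (row_of f *m (row_of g)^T) 0 0 = dot f g.
Proof.
rewrite mxE /dot -(sum_enum_val (fun x => f x * g x)).
by apply: eq_bigr => i _; rewrite !mxE.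
Qed.

Lemma row_of_entry (v : 'rV[R]_#|V|) : row_of (fun x => v 0 (enum_rank x)) = v.
Proof. by apply/rowP => i; rewrite mxE enum_valK. Qed.

Lemma laplacian_mul (Y : 'cV[R]_#|V|) x :
  (laplacian R e *m Y) (enum_rank x) 0 = lap e (entry Y) x.
Proof.
rewrite mulmxBl mxE mul_diag_mx !mxE enum_rankK /lap sumrB sumr_const.
congr (_ - _).
  rewrite mulr_natl; congr (_ *+ _).
  by rewrite /degree cardsE.
rewrite [RHS]big_mkcond -sum_enum_val; apply: eq_bigr => i _.
rewrite !mxE enum_rankK /entry enum_valK.
by case: (e x _); rewrite ?mul1r ?mul0r.
Qed.

Lemma laplacian_sym : (laplacian R e)^T = laplacian R e.
Proof.
rewrite /laplacian linearB /= tr_diag_mx; congr (_ - _).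
by apply/matrixP => i j; rewrite !mxE tree_sym.
Qed.

Lemma row_of_laplacian f : row_of f *m laplacian R e = row_of (lap e f).
Proof.
apply: trmx_inj; rewrite trmx_mul laplacian_sym; apply/colP => i.
rewrite -(enum_valK i) laplacian_mul !mxE !enum_rankK.
by apply: eq_lap => z; rewrite /entry !mxE enum_rankK.
Qed.

Lemma energy_eq0_const f : energy e f = 0 -> forall x y, f x = f y.
Proof.
move=> E0; have edge x z : e x z -> f x = f z.
  move=> exz; apply/eqP; rewrite -subr_eq0 -sqrf_eq0 expr2.
  have /eqP := dot_lapE (tree_sym tree) f f; rewrite -/(energy e f) E0 mul0rn eq_sym.
  rewrite psumr_eq0 => [/allP/(_ x)|y _]; last first.
    by apply: sumr_ge0 => w _; rewrite -expr2 sqr_ge0.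
  rewrite mem_index_enum => /(_ isT); rewrite psumr_eq0 => [/allP/(_ z)|w _]; last first.
    by rewrite -expr2 sqr_ge0.
  by rewrite mem_index_enum exz => /(_ isT).
move=> x y; have /connectP[p pp ->] := tree_conn tree x y.
by elim: p x pp => //= z p IHp x /andP[/edge -> /IHp].
Qed.

Lemma second_smallest_rayleigh mu :
    second_smallest_eigenvalue (laplacian R e) mu ->
  0 < mu /\ (forall f, \sum_x f x = 0 -> mu * dot f f <= energy e f).
Proof.
case=> s [sorted_s charL size_s <-].
have psd (v : 'rV[R]_#|V|) : 0 <= (v *m laplacian R e *m v^T) 0 0.
  rewrite -(row_of_entry v) row_of_laplacian row_of_dot dotC.
  exact: energy_ge0 (tree_sym tree) _.
pose u := row_of (fun=> 1).
have uL : u *m laplacian R e = 0.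
  rewrite row_of_laplacian; apply/rowP => i; rewrite !mxE /lap big1 // => z _.
  exact: subrr.
have ker (v : 'rV[R]_#|V|) : v *m laplacian R e = 0 -> (v <= u)%MS.
  pose f x := v 0 (enum_rank x); rewrite -(row_of_entry v) -/f => vL.
  have E0 : energy e f = 0.
    by rewrite /energy dotC -row_of_dot -row_of_laplacian vL mul0mx mxE.
  have [x _] : exists x : V, x \in V by apply/card_gt0P; case: tree.
  apply/sub_rVP; exists (f x); apply/rowP => i; rewrite !mxE mulr1.
  exact: energy_eq0_const E0 _ _.
split.
  exact: (second_eigenvalue_gt0 laplacian_sym psd charL sorted_s size_s ker).
move=> f f0; rewrite -row_of_dot /energy dotC -row_of_dot -row_of_laplacian.
apply: (second_eigenvalue_rayleigh laplacian_sym psd charL sorted_s size_s uL ker).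
  have [x _] : exists x : V, x \in V by apply/card_gt0P; case: tree.
  apply/eqP => /rowP/(_ (enum_rank x)); rewrite !mxE => /eqP.
  by rewrite oner_eq0.
rewrite row_of_dot -[RHS]f0; apply: eq_bigr => x _; exact: mulr1.
Qed.

(** The cover is nonempty because otherwise [y] would vanish nowhere and keep its sign along every
    edge, whereas an eigenvector for a positive eigenvalue has sum 0. *)
Lemma characteristic_setP X : is_characteristic_set R e X ->
  exists mu (y : V -> R), [/\ forall x, lap e y x = mu * y x,
    forall f, \sum_x f x = 0 -> mu * dot f f <= energy e f,
    exists x, x \in cover X &
    forall v, v \in cover X <->
      exists2 u, e v u & (y v = 0 /\ y u != 0) \/ y v * y u < 0].
Proof.
case=> Y [[mu [/second_smallest_rayleigh[mu_gt0 ray] nY0 LY] ->]].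
pose y := entry Y.
have lapy x : lap e y x = mu * y x by rewrite -laplacian_mul LY mxE.
have coverP v : reflect (exists2 u, e v u & (y v = 0 /\ y u != 0) \/ y v * y u < 0)
   (v \in cover ([set [set v] | v in characteristic_vertices e Y]
                 :|: characteristic_edges e Y)).
  apply: (iffP bigcupP) => [[A]|[u evu [[yv yu]|yuv]]].
  - rewrite in_setU => /orP[/imsetP[w + ->] /set1P ->|].
      rewrite inE => /andP[/eqP yw /existsP[u /andP[ewu yu]]].
      by exists u => //; left.
    rewrite inE => /existsP[a /existsP[b /and3P[eab yab /eqP ->]]].
    rewrite !inE => /orP[] /eqP ->; first by exists b => //; right.
    by exists a; [rewrite tree_sym | right; rewrite mulrC].
  - exists [set v]; rewrite ?set11 // in_setU imset_f //.
    by rewrite inE; apply/andP; split; [exact/eqP | apply/existsP; exists u; rewrite evu].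
  - exists [set v; u]; rewrite ?set21 // in_setU; apply/orP; right.
    rewrite inE; apply/existsP; exists v; apply/existsP; exists u.
    by rewrite evu yuv /=.
exists mu, y; split=> // [|v]; last by split=> /coverP.
have sumy : \sum_x y x = 0.
  have : mu * \sum_x y x = 0.
    rewrite big_distrr /= -(eq_bigr _ (fun x _ => lapy x)).
    transitivity (dot (fun=> 1) (lap e y)); first by apply: eq_bigr => x _; rewrite mul1r.
    rewrite dot_lapC; last exact: tree_sym.
    by apply: big1 => x _; rewrite /lap big1 ?mulr0 // => z _; exact: subrr.
  by move/eqP; rewrite mulf_eq0 gt_eqF //= => /eqP.
have [x0 yx0] : exists x, y x != 0.
  apply/existsP; apply: contraNT nY0; rewrite negb_exists => /forallP y0.
  apply/eqP/colP => i; rewrite mxE; have := y0 (enum_val i).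
  by rewrite negbK /y /entry enum_valK => /eqP.
apply/existsP; apply: contraTT isT; rewrite negb_exists => /forallP none.
have same x z : e x z -> 0 < y x * y x0 -> 0 < y z * y x0.
  move=> exz xpos.
  have nx : y x != 0 by apply: contraTneq xpos => ->; rewrite mul0r ltxx.
  have nz : y z != 0.
    apply/negP => /eqP yz; have /negP := none z; apply.
    by apply/coverP; exists x; [rewrite (tree_sym tree) | left].
  have : 0 <= y x * y z.
    rewrite leNgt; apply/negP => lt; have /negP := none x; apply.
    by apply/coverP; exists z => //; right.
  rewrite le_eqVlt eq_sym mulf_eq0 (negbTE nx) (negbTE nz) /= => xz.
  have : 0 < (y x * y z) * (y x * y x0) by rewrite mulr_gt0.
  have -> : (y x * y z) * (y x * y x0) = y x ^+ 2 * (y z * y x0) by ring.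
  by rewrite pmulr_rgt0 // exprn_even_gt0.
have pos x : 0 < y x * y x0.
  have x0pos : 0 < y x0 * y x0 by rewrite -expr2 exprn_even_gt0.
  have /connectP[p pp ->] := tree_conn tree x0 x.
  elim: p {1 3 4}x0 x0pos pp => //= z p IHp w wpos /andP[ewz pz].
  by apply: IHp pz; exact: same ewz wpos.
suff : 0 < \sum_x y x * y x0 by rewrite -big_distrl /= sumy mul0r ltxx.
rewrite (bigD1 x0) //= ltr_pwDl ?pos // sumr_ge0 // => x _; exact: ltW.
Qed.

End LaplacianMatrix.
(** * Comparison of branches *)

Section Comparison.
Variables (R : realType).

Section Branches.
Variables (V : finType) (e : rel V).
Hypothesis tree : is_tree e.
Variables (a r : V).
Hypothesis ear : e a r.

(** The union of the branches at [r] other than the one through [a], without [r]. *)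
Definition coside (a r : V) : {set V} := ~: (r |: side e a r).

Lemma in_coside x : (x \in coside a r) = (x != r) && (x \notin side e a r).
Proof. by rewrite in_setC in_setU1 negb_or. Qed.

Lemma side_nbr x z : x \in side e a r -> e x z -> (z \in side e a r) || (z == r).
Proof.
move=> xs exz; have [//|zs /=] := boolP (z \in side e a r).
by have [_ ->] := side_exit tree ear exz xs zs.
Qed.

Lemma coside_nbr x z : x \in coside a r -> e x z -> (z \in coside a r) || (z == r).
Proof.
rewrite !in_coside => /andP[nxr xs] exz; have [//|nzr] := eqVneq z r.
rewrite orbF; apply: contra nxr => zs; apply/eqP.
by have [] := side_exit tree ear _ zs xs; rewrite // (tree_sym tree).
Qed.

Lemma common_side x y : x \notin side e a r -> y \in side e a r ->
  common e r x y = 0%N.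
Proof.
move=> xs ys; rewrite (commonC tree); apply: common_separated.
exact: (dist_side_root tree ear ys xs).
Qed.

Lemma common_coside x y : x \notin coside a r -> y \in coside a r ->
  common e r x y = 0%N.
Proof.
rewrite !in_coside negb_and !negbK => /orP[/eqP -> _|xs /andP[_ ys]].
  exact: common_root.
by apply: common_separated; exact: (dist_side_root tree ear xs ys).
Qed.

Lemma side_coside_separated x y : x \in side e a r -> y \in coside a r ->
  (x != y) && ~~ e x y.
Proof.
rewrite in_coside => xs /andP[nyr ys]; apply/andP; split.
  by apply: contraNneq ys => <-.
by apply: contraNN nyr => exy; have [_ ->] := side_exit tree ear exy xs ys.
Qed.

Variables (X : {set {set V}}) (mu : R) (y : V -> R).
Hypothesis lapy : forall x, lap e y x = mu * y x.
Hypothesis cover_y : forall v, v \in cover X <->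
  exists2 u, e v u & (y v = 0 /\ y u != 0) \/ y v * y u < 0.

(** When [y r = 0], the restriction of [y] qualifies: were it zero, the eigenvalue equation at [r]
    would make [y] vanish at [a] too, so at every neighbour of [r]. When [y] changes sign from [r]
    to [u], that [u] is not [a], and [nodal_branch] would forbid the change if all energies were
    high. *)
Lemma coside_low_energy : r \in cover X -> a \notin cover X ->
  exists f : V -> R, [/\ supported (coside a r) f, 0 < dot f f &
    energy e f <= mu * dot f f].
Proof.
have sym := tree_sym tree.
have era : e r a by rewrite sym.
have nbr u : e r u -> u != a -> u \in coside a r.
  move=> eru nua; rewrite in_coside; apply/andP; split.
    by apply: contraTneq eru => ->; rewrite tree_irr.
  apply: contra nua => us; apply/eqP.
  by have [] := side_exit tree ear _ us (sideN_root e a r); rewrite // sym.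
move=> /cover_y[u eru [[yr yu]|yru]] aX.
  pose f x := if x \in coside a r then y x else 0.
  have Ef : energy e f = mu * dot f f by apply: energy_restrict yr coside_nbr.
  suff [x fx] : exists x, f x != 0.
    exists f; split; rewrite ?Ef //; last exact: dot_gt0 fx.
    by move=> z /negbTE; rewrite /f => ->.
  apply/existsP; apply: contraNT yu; rewrite negb_exists => /forallP f0.
  have y0 z : e r z -> z != a -> y z = 0.
    by move=> erz nza; have := f0 z; rewrite /f nbr // negbK => /eqP.
  have [ua|] := eqVneq u a; last by move=> nua; rewrite (y0 u).
  have := lapy r; rewrite yr mulr0 /lap (bigD1 a) //= big1 => [|z /andP[erz nza]].
    by rewrite ua yr addr0 sub0r => /eqP; rewrite oppr_eq0.
  by rewrite yr y0 // subrr.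
apply: contrapT => none.
have nua : u != a.
  apply: contraNneq aX => <-; apply/cover_y; exists r; rewrite 1?sym //.
  by right; rewrite mulrC.
have high f : supported (coside a r) f -> mu * dot f f <= energy e f.
  move=> supf; rewrite leNgt; apply/negP => lt; apply: none.
  exists f; split=> //; last exact: ltW.
  rewrite lt_def dot_ge0 andbT; apply: contraTneq lt => ->.
  by rewrite mulr0 -leNgt energy_ge0.
have eur : e u r by rewrite sym.
have [] := nodal_branch sym lapy coside_nbr high (nbr u eru nua) eur.
by rewrite mulrC leNgt yru.
Qed.

End Branches.

Variables (V V0 : finType) (e : rel V) (e0 : rel V0).
Hypotheses (tree : is_tree e) (tree0 : is_tree e0).
Variables (a r : V) (a0 r0 : V0).
Hypotheses (ear : e a r) (ear0 : e0 a0 r0).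
Variables (mu mu0 : R) (y0 : V0 -> R) (X0 : {set {set V0}}).
Hypothesis rayleigh : forall f : V -> R, \sum_x f x = 0 -> mu * dot f f <= energy e f.
Hypothesis rayleigh0 : forall f : V0 -> R, \sum_x f x = 0 -> mu0 * dot f f <= energy e0 f.
Hypothesis lapy0 : forall x, lap e0 y0 x = mu0 * y0 x.
Hypothesis cover_y0 : forall v, v \in cover X0 <->
  exists2 u, e0 v u & (y0 v = 0 /\ y0 u != 0) \/ y0 v * y0 u < 0.
Variables (phi : V0 -> V) (psi : V -> V0).
Hypothesis phi_in : forall x, x \in side e0 a0 r0 -> phi x \in side e a r.
Hypothesis phi_inj : {in side e0 a0 r0 &, injective phi}.
Hypothesis phi_common : forall x y, x \in side e0 a0 r0 -> y \in side e0 a0 r0 ->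
  (common e0 r0 x y <= common e r (phi x) (phi y))%N.
Hypothesis psi_in : forall x, x \in coside e a r -> psi x \in coside e0 a0 r0.
Hypothesis psi_inj : {in coside e a r &, injective psi}.
Hypothesis psi_common : forall x y, x \in coside e a r -> y \in coside e a r ->
  (common e r x y <= common e0 r0 (psi x) (psi y))%N.

(* A function on side a0 r0 of Rayleigh quotient below mu0 would move to side a r,
   so mu < mu0 as coside a r has one of quotient at most mu; this last one moves
   to coside a0 r0, giving two separated functions of quotient at most mu0. *)
Lemma characteristic_outside_side (f : V -> R) :
    supported (coside e a r) f -> 0 < dot f f -> energy e f <= mu * dot f f ->
  forall x, x \in side e0 a0 r0 -> x \notin cover X0.
Proof.
move=> supf f_gt0 Ef.
have high g : supported (side e0 a0 r0) g -> mu0 * dot g g <= energy e0 g.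
  move=> supg; rewrite leNgt; apply/negP => lt.
  have g_gt0 : 0 < dot g g.
    rewrite lt_def dot_ge0 andbT; apply: contraTneq lt => ->.
    by rewrite mulr0 -leNgt energy_ge0 //; exact: tree_sym tree0.
  have [h [suph h_gt0 Eh]] := energy_transfer tree0 tree (sideN_root e0 a0 r0)
    (sideN_root e a r) (common_side tree ear) phi_in phi_inj phi_common supg g_gt0.
  have ltEh : energy e h < mu0 * dot h h.
    rewrite -(ltr_pM2r g_gt0) (le_lt_trans Eh) //.
    by rewrite [X in _ < X]mulrAC ltr_pM2r.
  have := rayleigh_separated (tree_sym tree) rayleigh
    (side_coside_separated tree ear) suph supf f_gt0 Ef.
  move=> /le_lt_trans/(_ ltEh); rewrite ltr_pM2r // => lt_mu.
  have cosideN_root (W : finType) (e' : rel W) b s : s \notin coside e' b s.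
    by rewrite in_coside eqxx.
  have [f0 [supf0 f0_gt0 Ef0]] := energy_transfer tree tree0 (cosideN_root _ e a r)
    (cosideN_root _ e0 a0 r0) (common_coside tree0 ear0) psi_in psi_inj psi_common
    supf f_gt0.
  have leEf0 : energy e0 f0 <= mu0 * dot f0 f0.
    apply: le_trans (_ : mu * dot f0 f0 <= _); last by rewrite ler_pM2r // ltW.
    rewrite -(ler_pM2r f_gt0) (le_trans Ef0) // [X in _ <= X]mulrAC.
    by rewrite ler_pM2r.
  have := rayleigh_separated (tree_sym tree0) rayleigh0
    (side_coside_separated tree0 ear0) supg supf0 f0_gt0 leEf0.
  by rewrite leNgt lt.
move=> x xs; apply/negP => /cover_y0[u exu].
have [y_ge0 yx0] := nodal_branch (tree_sym tree0) lapy0 (side_nbr tree0 ear0) high xs exu.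
by case=> [[/yx0 ->]|]; [rewrite eqxx | rewrite ltNge y_ge0].
Qed.

End Comparison.
Local Close Scope ring_scope.

(** * The trees T(l, m, p) *)

(** In a longer cycle, a vertex of maximal [h] has two distinct neighbours, neither of larger
    [h]. *)
Lemma rank_acyclic (V : finType) (e : rel V) (h : V -> nat) : symmetric e ->
    (forall x y z, e x y -> e x z -> h y <= h x -> h z <= h x -> y = z) ->
  acyclic e.
Proof.
move=> sym uniq_le c /andP[cyc uc]; rewrite leqNgt; apply/negP => szc.
have [x0 x0c] : exists x0, x0 \in c.
  by case: c szc {cyc uc} => // x0 c _; exists x0; rewrite mem_head.
have [x xc xmax] : exists2 x, x \in c & forall y, y \in c -> h y <= h x.
  by case: (arg_maxnP h x0c) => x xc xmax; exists x.
have [i p rotc] := rot_to xc.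
have mem_p y : y \in x :: p -> h y <= h x by rewrite -rotc mem_rot; exact: xmax.
have szp : size (x :: p) = size c by rewrite -rotc size_rot.
have up : uniq (x :: p) by rewrite -rotc rot_uniq.
have cp : cycle e (x :: p) by rewrite -rotc rot_cycle.
case: p => [|y p] in {rotc} mem_p szp up cp; first by rewrite -szp in szc.
case/lastP: p => [|p z] in mem_p szp up cp; first by rewrite -szp in szc.
rewrite /= rcons_path last_rcons in cp; case/and3P: cp => exy _ ezx.
have yz : y = z.
  apply: (uniq_le x) => //; rewrite 1?sym //; apply: mem_p.
    by rewrite !inE eqxx orbT.
  by rewrite !inE mem_rcons mem_head !orbT.
by move: up; rewrite yz /= mem_rcons mem_head /= andbF.
Qed.

Section Broom.
Variables (l m p : nat).
Hypotheses (l_gt0 : 0 < l) (m_gt0 : 0 < m) (p_gt0 : 0 < p).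
Local Notation V := ('I_p + ('I_l + 'I_m))%type.
Local Notation e := (@Tlmp l m p).
Implicit Types x y z : V.

(* Position on a diametral path: the pendant vertices sit at 0 and p + 1. *)
Definition pos x : nat :=
  match x with inl i => i.+1 | inr (inl _) => 0 | inr (inr _) => p.+1 end.

(** Distinct vertices share a position only when they are pendant at the same end, hence at distance
    2. *)
Definition broom_dist x y : nat :=
  if x == y then 0 else if pos x == pos y then 2 else (pos x - pos y) + (pos y - pos x).

(** Total on [nat]: for [i >= p] the value is the first path vertex. *)
Definition pt i : V := inl (insubd (Ordinal p_gt0) i).

Lemma pos_pt i : i < p -> pos (pt i) = i.+1.
Proof. by move=> ltip; rewrite /= val_insubd ltip. Qed.

Lemma pos_inl (i : 'I_p) : 0 < pos (inl i) <= p.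
Proof. by rewrite /= ltn_ord. Qed.

Lemma pos_inj x y : 0 < pos x <= p -> pos x = pos y -> x = y.
Proof.
case: x y => [i|[i|i]] [j|[j|j]] //=; rewrite ?ltnn //.
- by move=> _ [] /ord_inj ->.
- by move=> _ [ip]; have := ltn_ord i; rewrite ip ltnn.
Qed.

Lemma Tlmp_pos x y : e x y =
  (0 < pos x <= p) && ((pos y == (pos x).+1) || (pos x == (pos y).+1)) ||
  (0 < pos y <= p) && ((pos y == (pos x).+1) || (pos x == (pos y).+1)).
Proof.
have lt (i : 'I_p) := ltn_ord i.
case: x y => [i|[i|i]] [j|[j|j]] /=; rewrite ?lt ?ltnn ?andbF ?orbF //=;
  try (have := lt i); try (have := lt j); lia.
Qed.

Lemma Tlmp_sym : symmetric e.
Proof. by move=> x y; rewrite !Tlmp_pos orbC; congr (_ || _); rewrite orbC. Qed.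

Lemma pos_le x : pos x <= p.+1.
Proof. by case: x => [i|[i|i]] //=; have := ltn_ord i; lia. Qed.

Lemma broom_distP x y :
  [\/ [/\ x = y, pos x = pos y & broom_dist x y = 0],
      [/\ x <> y, pos x = pos y, (pos x = 0 \/ pos x = p.+1) & broom_dist x y = 2] |
      [/\ x <> y, pos x <> pos y & broom_dist x y = (pos x - pos y) + (pos y - pos x)]].
Proof.
rewrite /broom_dist; have [->|nxy] := eqVneq x y; first by constructor 1.
have [pxy|npxy] := eqVneq (pos x) (pos y); last by constructor 3; split; exact/eqP.
constructor 2; split=> //; first exact/eqP.
have := pos_le x; case: (posnP (pos x)) => [|x_gt0]; first by left.
rewrite leq_eqVlt ltnS => /orP[/eqP|lexp]; first by right.
by case/eqP: nxy; apply: pos_inj; rewrite ?x_gt0.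
Qed.

Lemma broom_distxx x : broom_dist x x = 0.
Proof. by rewrite /broom_dist eqxx. Qed.

Lemma broom_dist_adjacent x y z : e x z -> broom_dist x y <= (broom_dist z y).+1.
Proof.
rewrite Tlmp_pos => exz; have lex := pos_le x; have lez := pos_le z.
case: (broom_distP x y) => -[*]; case: (broom_distP z y) => -[*]; lia.
Qed.

Lemma broom_dist_descent x y : x != y ->
  exists2 z, e x z & broom_dist x y = (broom_dist z y).+1.
Proof.
move=> nxy; have lex := pos_le x; have ley := pos_le y.
(* From position 0 the only move is up, even towards a vertex at the same position. A step onto an
   end position lands on [y] itself, which is then there. *)
pose up := (pos x < pos y) || (pos x == 0).
pose z := if up then if pos x == p then y else pt (pos x)
          else if pos x == 1 then y else pt (pos x).-2.
have zy : z = y \/ 0 < pos z <= p.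
  by rewrite /z /up; do 2 case: ifP => ?; try (by left); right; rewrite ?pos_pt; lia.
have posz : (pos x < pos y \/ pos x = 0) /\ pos z = (pos x).+1 \/
    pos y <= pos x /\ 0 < pos x /\ (pos z).+1 = pos x.
  case: (broom_distP x y) => -[]; first by move/eqP: nxy.
    by move=> *; rewrite /z /up; do 2 case: ifP => ?; rewrite ?pos_pt; lia.
  by move=> *; rewrite /z /up; do 2 case: ifP => ?; rewrite ?pos_pt; lia.
exists z; first by rewrite Tlmp_pos; lia.
case: (broom_distP x y) => -[]; first by move/eqP: nxy.
  by case: (broom_distP z y) => -[*]; lia.
move=> ? ?; case: zy => [zy|zp]; first by rewrite zy broom_distxx in posz *; lia.
by case: (broom_distP z y) => -[*]; lia.
Qed.

Lemma Tlmp_connect x y : connect e x y.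
Proof.
have [n] := ubnP (broom_dist x y); elim: n x => // n IHn x ltn.
have [->//|nxy] := eqVneq x y.
have [z exz dxy] := broom_dist_descent nxy.
by apply: connect_trans (connect1 exz) (IHn z _); rewrite -ltnS -dxy.
Qed.

Lemma Tlmp_dist : dist e =2 broom_dist.
Proof.
apply: dist_uniq; [exact: Tlmp_connect | exact: broom_distxx | |].
  exact: broom_dist_adjacent.
exact: broom_dist_descent.
Qed.

Lemma Tlmp_tree : is_tree e.
Proof.
split.
- exact: Tlmp_sym.
- by move=> x; apply/negP; rewrite Tlmp_pos; lia.
- by apply/card_gt0P; exists (pt 0).
- exact: Tlmp_connect.
(* Lifting position 0 above the path leaves every vertex with at most one neighbour of no larger
   rank. *)
pose h x := if pos x == 0 then p.+1 else pos x.
have hE x : pos x = 0 /\ h x = p.+1 \/ 0 < pos x /\ h x = pos x.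
  by rewrite /h; case: eqP; lia.
apply: (rank_acyclic (h := h)) => [|x y z]; first exact: Tlmp_sym.
rewrite !Tlmp_pos; have := hE x; have := hE y; have := hE z.
move=> ? ? ? exy exz ley lez; apply: pos_inj.
  by have := pos_le x; have := pos_le y; lia.
by have := pos_le x; have := pos_le y; have := pos_le z; lia.
Qed.

Lemma Tlmp_card : #|{: V}| = p + (l + m).
Proof. by rewrite !card_sum !card_ord. Qed.

Lemma Tlmp_diameter : diameter e = p.+1.
Proof.
apply/eqP; rewrite eqn_leq; apply/andP; split.
  apply/bigmax_leqP => x _; apply/bigmax_leqP => y _; rewrite Tlmp_dist.
  by have := pos_le x; have := pos_le y; case: (broom_distP x y) => -[*]; lia.
pose x : V := inr (inl (Ordinal l_gt0)); pose y : V := inr (inr (Ordinal m_gt0)).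
apply: leq_trans (leq_bigmax (F := fun u => \max_v dist e u v) x).
by apply: leq_trans (leq_bigmax (F := dist e x) y); rewrite Tlmp_dist /broom_dist /=; lia.
Qed.

Let last_v := pt p.-1.

Lemma pos_last : pos last_v = p.
Proof. by rewrite pos_pt; lia. Qed.

Let hub : {set V} := last_v |: [set inr (inr j) | j : 'I_m].

Lemma card_hub : #|hub| = m.+1.
Proof.
rewrite cardsU1 card_imset; last by move=> i j [].
by rewrite card_ord; case: imsetP => // -[].
Qed.

Lemma hubP x : (x \in hub) = (p <= pos x).
Proof.
rewrite in_setU1; apply/orP/idP => [[/eqP ->|/imsetP[j _ ->]]|].
- by rewrite pos_last.
- by rewrite /=; lia.
move=> le; case: x le => [i|[i|i]] le.
- left; apply/eqP; apply: pos_inj; first by rewrite pos_inl.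
  by rewrite pos_last; have /andP[_] := pos_inl i; lia.
- by move: le; rewrite /=; lia.
- by right; apply/imsetP; exists i.
Qed.

Lemma adjacent_last x : p < pos x -> e x last_v.
Proof. by rewrite Tlmp_pos pos_last; have := pos_le x; lia. Qed.

(* The last path vertex is the centroid as soon as its m pendant neighbours
   outnumber what lies beyond its other neighbour. *)
Lemma Tlmp_centroid : l + p <= m.+1 -> forall v, v \in centroid e -> v = last_v.
Proof.
move=> le v; rewrite inE => /forallP/(_ last_v); apply: contraTeq => nv.
have tree := Tlmp_tree; rewrite -ltnNge.
have nvp : pos v <> p.
  by move=> vp; case/eqP: nv; apply: pos_inj; rewrite ?pos_last vp ?p_gt0 ?leqnn.
have small : weight e last_v < m.+1.
  rewrite ltnS; apply: (weight_le tree) => a; rewrite Tlmp_pos pos_last => eva.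
  have [az|pa] := boolP (pos a == p.+1).
    apply: leq_trans (_ : #|[set a]| <= m); last by rewrite cards1.
    apply: subset_leq_card; apply/subsetP => x; rewrite in_side !Tlmp_dist inE.
    have lex := pos_le x; have := pos_last.
    case: (broom_distP a x) => -[*]; first exact/eqP/esym.
      by case: (broom_distP last_v x) => -[*]; lia.
    by case: (broom_distP last_v x) => -[*]; lia.
  have : side e a last_v \subset ~: hub.
    apply/subsetP => x; rewrite in_setC hubP in_side !Tlmp_dist.
    have lex := pos_le x; have := pos_last.
    case: (broom_distP a x) => -[*]; case: (broom_distP last_v x) => -[*]; lia.
  move/subset_leq_card/leq_trans; apply.
  rewrite -(leq_add2l #|hub|) cardsC card_hub Tlmp_card; lia.
apply: leq_trans small _.
(* A vertex pendant at [last_v] has all other vertices in one branch; from a vertex off the hub, the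
   branch towards [last_v] contains the whole hub. *)
have [vh|vh] := boolP (v \in hub); rewrite hubP in vh.
  have ev : e v last_v by apply: adjacent_last; lia.
  apply: leq_trans (weight_ge tree ev).
  apply: leq_trans (_ : #|[set~ v]| <= _); first by rewrite cardsC1 Tlmp_card; lia.
  apply: subset_leq_card; apply/subsetP => x; rewrite in_setC1 in_side !Tlmp_dist.
  move=> /eqP nxv; have lex := pos_le x; have lev := pos_le v; have lastp := pos_last.
  case: (broom_distP last_v x) => -[*]; case: (broom_distP v x) => -[*];
    try lia; by case: nxv.
rewrite eq_sym in nv; have [a eva va] := side_cover tree nv.
apply: leq_trans (weight_ge tree eva); rewrite -card_hub.
apply: subset_leq_card; apply/subsetP => x; rewrite hubP in_side !Tlmp_dist => xh.
rewrite in_side !Tlmp_dist in va; rewrite Tlmp_pos in eva.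
have lex := pos_le x; have lea := pos_le a; have lastp := pos_last.
have posa : pos a = (pos v).+1.
  case: (broom_distP a last_v) => -[*]; case: (broom_distP v last_v) => -[*]; lia.
by case: (broom_distP a x) => -[*]; case: (broom_distP v x) => -[*]; lia.
Qed.

End Broom.
(** * Embeddings of branches *)

Section Geodesic.
Variables (V : finType) (e : rel V).
Hypothesis tree : is_tree e.
Local Notation d := (dist e).
Let conn := tree_conn tree.

Lemma geodesic_exists x y : exists u : nat -> V, [/\ u 0 = x, u (d x y) = y,
  forall i, i < d x y -> e (u i) (u i.+1) &
  forall i, i <= d x y -> d (u i) y = d x y - i].
Proof.
pose par z := odflt z [pick w | e z w & d z y == (d w y).+1].
have parP z : z != y -> e z (par z) /\ d z y = (d (par z) y).+1.
  move=> nzy; rewrite /par; case: pickP => [w /andP[ezw /eqP dzw] //|none].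
  have [w ezw dzw] := dist_descent conn nzy.
  by have := none w; rewrite /= ezw dzw eqxx.
pose u i := iter i par x.
have du i : i <= d x y -> d (u i) y = d x y - i.
  elim: i => [|i IHi] lti; first by rewrite subn0.
  have [] := parP (u i); last by rewrite (IHi (ltnW lti)) /=; lia.
  by rewrite -(dist_eq0 conn) (IHi (ltnW lti)); lia.
exists u; split=> // [|i lti].
  by apply/eqP; rewrite -(dist_eq0 conn) du // subnn.
have [] // := parP (u i).
by rewrite -(dist_eq0 conn) (du _ (ltnW lti)); lia.
Qed.

Lemma walk_dist (u : nat -> V) N i j : (forall i, i < N -> e (u i) (u i.+1)) ->
  i <= j -> j <= N -> d (u i) (u j) <= j - i.
Proof.
move=> adj leij lejN; rewrite -{1}(subnKC leij); have: i + (j - i) <= N by lia.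
elim: (j - i) => [|s IHs] le; first by rewrite addn0 distxx.
have := dist_triangle conn (u i) (u (i + s)) (u (i + s.+1)).
have := dist_adjacent conn (u (i + s.+1)) (adj (i + s) _).
rewrite addnS distxx in le * => /(_ le); have := IHs (ltnW le); lia.
Qed.

End Geodesic.

(** * The two parts of a tree cut at the end of a geodesic *)

Section AlongGeodesic.
Variables (V : finType) (e : rel V).
Hypothesis tree : is_tree e.
Local Notation d := (dist e).
Let conn := tree_conn tree.
Let sym := tree_sym tree.

Variables (D : nat) (u : nat -> V).
Hypothesis D_gt0 : 0 < D.
Hypothesis u_adj : forall i, i < D -> e (u i) (u i.+1).
Hypothesis u_root : forall i, i <= D -> d (u i) (u D) = D - i.

Local Notation r := (u D).
Local Notation a := (u D.-1).
(** In the application [u 0] is a centroid vertex and [r] a characteristic one; [beyond] is [u 0]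
    with all that hangs from it away from [r]. *)
Local Notation beyond := (side e (u 0) (u 1)).

Lemma geodesic_last_adj : e a r.
Proof. by have := @u_adj D.-1; rewrite prednK //; apply; lia. Qed.

Lemma u_dist i j : i <= D -> j <= D -> d (u i) (u j) <= (i - j) + (j - i).
Proof.
move=> iD jD; have [le|lt] := leqP i j; first by have := walk_dist tree u_adj le jD; lia.
by rewrite (distC conn sym); have := walk_dist tree u_adj (ltnW lt) iD; lia.
Qed.

Lemma beyond_dist x i : x \in beyond -> i <= D -> d x (u i) <= d (u 0) x + i.
Proof.
move=> xb iD; apply: leq_trans (dist_triangle conn x (u 0) (u i)) _.
by rewrite (distC conn sym) leq_add2l; have := @u_dist 0 i; lia.
Qed.

Lemma beyond_root_dist x : x \in beyond -> d r x = d (u 0) x + D.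
Proof.
move=> xb; have e01 : e (u 0) (u 1) by exact: u_adj.
have rb : r \notin beyond.
  rewrite in_side (u_root (leq0n D)) (u_root D_gt0); lia.
rewrite (distC conn sym) (dist_cut tree e01 xb rb) (u_root D_gt0) (distC conn sym x).
lia.
Qed.

Lemma beyond_side x : x \in beyond -> x \in side e a r.
Proof.
move=> xb; rewrite in_side (beyond_root_dist xb) (distC conn sym).
by have := beyond_dist xb (leq_pred D); lia.
Qed.

Lemma geodesic_side i : i < D -> u i \in side e a r.
Proof.
move=> iD; rewrite in_side (distC conn sym r) (u_root (ltnW iD)).
by have := @u_dist D.-1 i; lia.
Qed.

(** The geodesic has [D] distinct vertices before [r], and the vertices of [beyond] other than [u 0]
    are farther from [r] than these. This bounds the coside from above. *)
Lemma card_side_ge : D + #|beyond :\ u 0| <= #|side e a r|.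
Proof.
pose P := [set u i | i : 'I_D].
have injP : injective (fun i : 'I_D => u i).
  move=> i j eqij; apply: ord_inj; have := u_root (ltnW (ltn_ord i)).
  by rewrite eqij (u_root (ltnW (ltn_ord j))); have := ltn_ord i; have := ltn_ord j; lia.
have cardP : #|P| = D by rewrite card_imset // card_ord.
have : [disjoint P & beyond :\ u 0].
  apply/pred0P => x /=; apply/negP => /andP[/imsetP[i _ ->]].
  rewrite in_setD1 => /andP[nui /beyond_root_dist].
  rewrite -(dist_eq0 conn) in nui.
  rewrite (distC conn sym) (u_root (ltnW (ltn_ord i))) (distC conn sym); lia.
rewrite -(leq_card_setU _ _).2 => /eqP cardU; rewrite -{1}cardP -cardU.
apply/subset_leq_card/subsetP => x; rewrite in_setU in_setD1.
by case/orP=> [/imsetP[i _ ->]|/andP[_ /beyond_side //]]; exact: geodesic_side.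
Qed.

Section Embedding.
Variables (l m p : nat).
Hypotheses (l_gt0 : 0 < l) (m_gt0 : 0 < m) (p_gt0 : 0 < p) (D_lt : D < p).
Local Notation V0 := ('I_p + ('I_l + 'I_m))%type.
Local Notation e0 := (@Tlmp l m p).
Let tree0 : is_tree e0 := Tlmp_tree l_gt0 m_gt0 p_gt0.
Let dist0 := Tlmp_dist l_gt0 m_gt0 p_gt0.
Let dist0P := broom_distP l_gt0 m_gt0 p_gt0.

(** With this [q], the root [r0] has position [p - D], at distance [D] from the last path vertex,
    and [a0] is the next vertex in that direction. *)
Local Notation q := (p.-1 - D).
Local Notation r0 := (pt l m p_gt0 q).
Local Notation a0 := (pt l m p_gt0 q.+1).

Lemma Tlmp_pos_r0 : pos r0 = q.+1. Proof. by rewrite pos_pt; lia. Qed.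
Lemma Tlmp_pos_a0 : pos a0 = q.+2. Proof. by rewrite pos_pt; lia. Qed.

Lemma Tlmp_root_adj : e0 a0 r0.
Proof. by rewrite (Tlmp_pos l_gt0 m_gt0 p_gt0) Tlmp_pos_r0 Tlmp_pos_a0; lia. Qed.

Lemma Tlmp_side x : (x \in side e0 a0 r0) = (q.+1 < pos x).
Proof.
rewrite in_side !dist0; have := Tlmp_pos_r0; have := Tlmp_pos_a0.
by case: (dist0P a0 x) => -[*]; case: (dist0P r0 x) => -[*]; lia.
Qed.

Lemma Tlmp_coside x : (x \in coside e0 a0 r0) = (pos x < q.+1).
Proof.
rewrite in_coside Tlmp_side -leqNgt ltn_neqAle; congr (_ && _).
congr (~~ _).
apply/eqP/eqP => [->|xr]; first by rewrite Tlmp_pos_r0.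
by apply: pos_inj; rewrite xr ?Tlmp_pos_r0; lia.
Qed.

Lemma Tlmp_root_dist x : dist e0 r0 x = (pos x - q.+1) + (q.+1 - pos x).
Proof.
rewrite dist0; have := Tlmp_pos_r0; have := pos_le l_gt0 m_gt0 p_gt0 x.
by case: (dist0P r0 x) => -[*]; lia.
Qed.

(** * From the side in [Tlmp] into the side in the given tree *)

Section Side.
Hypothesis beyond_card : m <= #|beyond :\ u 0|.

(** The path vertex at position [p - i] goes to [u i], and those pendant at the last path vertex go
    to distinct vertices of [beyond]. Those pendant at the first one lie outside the side and get a
    default value. *)
Definition side_map (x : V0) : V :=
  match x with
  | inl i => u (p.-1 - i)
  | inr (inl _) => u 0
  | inr (inr j) => nth (u 0) (enum (beyond :\ u 0)) j
  end.

Lemma side_map_pendant (j : 'I_m) : side_map (inr (inr j)) \in beyond :\ u 0.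
Proof.
rewrite -mem_enum /= mem_nth // -cardE; exact: leq_trans (ltn_ord j) beyond_card.
Qed.

Variant side_map_spec x : Prop :=
| SideMapPath i of i < D & side_map x = u i & pos x = p - i
    & x = pt l m p_gt0 (p.-1 - i)
| SideMapPendant j of side_map x \in beyond & side_map x != u 0 & pos x = p.+1
    & x = inr (inr j).

Lemma side_mapP x : x \in side e0 a0 r0 -> side_map_spec x.
Proof.
rewrite Tlmp_side; case: x => [i|[i|j]]; rewrite /= ?ltn0 // => lti.
  have := ltn_ord i => ltip.
  apply: (@SideMapPath _ (p.-1 - i)); rewrite //=; try lia.
  congr inl; apply: ord_inj; rewrite val_insubd; case: ifP; lia.
have := side_map_pendant j; rewrite in_setD1 => /andP[nu0 jb].
exact: (@SideMapPendant _ j).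
Qed.

Lemma side_map_in x : x \in side e0 a0 r0 -> side_map x \in side e a r.
Proof.
case/side_mapP=> [i iD -> _ _|j jb _ _ _]; first exact: geodesic_side.
exact: beyond_side.
Qed.

Lemma side_map_inj : {in side e0 a0 r0 &, injective side_map}.
Proof.
move=> x y xs ys eqxy; have pend z : z \in beyond -> z != u 0 -> D < d r z.
  by move=> zb; rewrite -(dist_eq0 conn) (distC conn sym) (beyond_root_dist zb); lia.
have path i : i < D -> d r (u i) = D - i.
  by move=> iD; rewrite (distC conn sym) u_root // ltnW.
case: (side_mapP xs) eqxy => [i iD -> posx xE|j jb jn posx xE];
  case: (side_mapP ys) => [i' iD' -> posy yE|j' jb' jn' posy yE] eqxy.
- by rewrite xE yE; congr pt; have := path i iD; rewrite eqxy path //; lia.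
- by have := pend _ jb' jn'; rewrite -eqxy path //; lia.
- by have := pend _ jb jn; rewrite eqxy path //; lia.
have size_enum (i : 'I_m) : i < size (enum (beyond :\ u 0)).
  by rewrite -cardE; exact: leq_trans (ltn_ord i) beyond_card.
move: eqxy; rewrite xE yE /= => /eqP.
by rewrite (nth_uniq _ (size_enum j) (size_enum j') (enum_uniq _)) => /eqP/ord_inj ->.
Qed.

(** Path vertices keep their distance to the root. Pendant vertices go beyond [u 0], so their paths
    to [r] still share the whole geodesic, and their depth is at least [D + 1]. *)
Lemma side_map_common x y : x \in side e0 a0 r0 -> y \in side e0 a0 r0 ->
  common e0 r0 x y <= common e r (side_map x) (side_map y).
Proof.
move=> xs ys; rewrite /common !Tlmp_root_dist dist0.
have path i : i < D -> d r (u i) = D - i.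
  by move=> iD; rewrite (distC conn sym) u_root // ltnW.
have pend z : z != u 0 -> 0 < d (u 0) z.
  by rewrite lt0n (dist_eq0 conn) eq_sym.
have lb : (pos x - pos y) + (pos y - pos x) <= broom_dist x y.
  by case: (dist0P x y) => -[*]; lia.
have depth_path i (z : V0) : i < D -> pos z = p - i ->
    (pos z - q.+1) + (q.+1 - pos z) = D - i by move=> ? ->; lia.
have depth_pendant (z : V0) : pos z = p.+1 -> (pos z - q.+1) + (q.+1 - pos z) = D.+1.
  by move=> ->; lia.
case: (side_mapP xs) => [i iD -> posx _|j jb jn posx _];
  case: (side_mapP ys) => [i' iD' -> posy _|j' jb' jn' posy _].
- have le := u_dist (ltnW iD) (ltnW iD'); rewrite !path //.
  rewrite (depth_path _ _ iD posx) (depth_path _ _ iD' posy).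
  by rewrite posx posy in lb; lia.
- rewrite (depth_path _ _ iD posx) (depth_pendant _ posy) path // (beyond_root_dist jb').
  have := beyond_dist jb' (ltnW iD); rewrite (distC conn sym (u i)).
  by rewrite posx posy in lb; lia.
- rewrite (depth_pendant _ posx) (depth_path _ _ iD' posy) path // (beyond_root_dist jb).
  have := beyond_dist jb (ltnW iD').
  by rewrite posx posy in lb; lia.
- rewrite (depth_pendant _ posx) (depth_pendant _ posy).
  rewrite (beyond_root_dist jb) (beyond_root_dist jb').
  have pos_eq : pos x = pos y by rewrite posx.
  case: (dist0P x y) => -[]; [move=> <- _ -> | move=> _ _ _ -> | by []].
    by rewrite distxx; have := pend _ jn; lia.
  have := dist_triangle conn (side_map x) (u 0) (side_map y).
  rewrite (distC conn sym (side_map x) (u 0)); lia.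
Qed.

End Side.

(** * From the coside in the given tree into the coside in [Tlmp] *)

Section Coside.
Local Notation B := (coside e a r).
Hypothesis B_card : #|B| <= q + l.
Hypothesis B_depth : forall y, y \in B -> d r y <= q.+1.

(** The lexicographic order by distance to [r], then by [enum_rank], encoded in one number. *)
Let key y := d r y * #|V| + enum_rank y.

Definition depth_rank y := #|[set z in B | key z < key y]|.

Lemma key_le y z : d r y < d r z -> key y < key z.
Proof.
move=> lt; apply: leq_trans (_ : (d r y).+1 * #|V| <= _).
  by rewrite /key mulSn [X in _ < X]addnC ltn_add2l ltn_ord.
apply: leq_trans (leq_addr _ _); exact: leq_mul.
Qed.

Lemma key_inj : injective key.
Proof.
move=> y z eqk; have [lt|lt|eqd] := ltngtP (d r y) (d r z).
- by have := key_le lt; rewrite eqk ltnn.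
- by have := key_le lt; rewrite eqk ltnn.
by move: eqk; rewrite /key eqd => /addnI/ord_inj/enum_rank_inj.
Qed.

Lemma depth_rank_lt y z : y \in B -> key y < key z -> depth_rank y < depth_rank z.
Proof.
move=> yB lt; apply: proper_card; apply/properP; split.
  apply/subsetP => w; rewrite !inE => /andP[-> /ltn_trans]; exact.
by exists y; rewrite inE yB ?lt // ltnn.
Qed.

Lemma depth_rank_inj : {in B &, injective depth_rank}.
Proof.
move=> y z yB zB eqr; apply: key_inj; case: (ltngtP (key y) (key z)) => // lt.
- by have := depth_rank_lt yB lt; rewrite eqr ltnn.
- by have := depth_rank_lt zB lt; rewrite eqr ltnn.
Qed.

Lemma depth_rank_bound y : y \in B -> depth_rank y < q + l.
Proof.
move=> yB; apply: leq_trans B_card; apply: proper_card; apply/properP; split.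
  by apply/subsetP => w; rewrite inE => /andP[].
by exists y; rewrite // inE ltnn andbF.
Qed.

(** The path from [y] to [r] stays in [B] until it reaches [r], and its vertices there precede [y]
    in the order of [key]. *)
Lemma depth_le_rank y : y \in B -> d r y <= (depth_rank y).+1.
Proof.
have [N] := ubnP (d r y); elim: N y => // N IHN y ltN yB.
have nyr : y != r by move: yB; rewrite in_coside => /andP[].
have [z eyz dyz] := dist_descent conn nyr; rewrite !(distC conn sym _ r) in dyz.
rewrite dyz ltnS; have [->|nzr] := eqVneq z r; first by rewrite distxx.
have zB : z \in B.
  by have := coside_nbr tree geodesic_last_adj yB eyz; rewrite (negbTE nzr) orbF.
apply: leq_trans (IHN z _ zB) _; first by rewrite -ltnS -dyz.
by apply: depth_rank_lt => //; apply: key_le; rewrite dyz.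
Qed.

(* B is listed by distance to r and mapped to the path, then to the pendants:
   a vertex at distance h has at least h - 1 predecessors, so that no distance
   to the root decreases. *)
Definition coside_map y : V0 :=
  if depth_rank y < q then pt l m p_gt0 (q.-1 - depth_rank y)
  else inr (inl (insubd (Ordinal l_gt0) (depth_rank y - q))).

Lemma pos_coside_map y : pos (coside_map y) = q - depth_rank y.
Proof.
by rewrite /coside_map; case: ifP => h; rewrite ?pos_pt //=; lia.
Qed.

Lemma coside_map_in y : y \in B -> coside_map y \in coside e0 a0 r0.
Proof. by rewrite Tlmp_coside pos_coside_map; lia. Qed.

Lemma coside_map_inj : {in B &, injective coside_map}.
Proof.
move=> y z yB zB eqyz; apply: depth_rank_inj => //.
have := pos_coside_map y; have := pos_coside_map z; rewrite eqyz => ->.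
have := depth_rank_bound yB; have := depth_rank_bound zB.
have [lty|ley] := ltnP (depth_rank y) q; first lia.
have [ltz|lez] := ltnP (depth_rank z) q; first lia.
move: eqyz; rewrite /coside_map !ltnNge ley lez /= => -[/(congr1 val)].
rewrite !val_insubd; do 2 case: ifP => ?; lia.
Qed.

(** Rank [s] is sent to depth [minn s q + 1]. The images of distinct vertices share the whole path
    to the shallower one, or [q] edges when both are pendant. *)
Lemma coside_map_common x y : x \in B -> y \in B ->
  common e r x y <= common e0 r0 (coside_map x) (coside_map y).
Proof.
move=> xB yB; have [<-|nxy] := eqVneq x y.
  rewrite /common !distxx Tlmp_root_dist pos_coside_map.
  by have := depth_le_rank xB; have := B_depth xB; lia.
have neq_rank : depth_rank x <> depth_rank y.
  by move/(depth_rank_inj xB yB) => xy; rewrite xy eqxx in nxy.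
(* Distinct vertices at equal depth are not adjacent, hence at distance at least 2; so even at depth
   [q + 1] they share at most [q] edges. *)
have : common e r x y <= (minn q (minn (d r x) (d r y))).*2.
  have := common_le tree r x y.
  have [eqd|] := eqVneq (d r x) (d r y); last first.
    by have := B_depth xB; have := B_depth yB; lia.
  have [z exz dxz] := dist_descent conn nxy.
  have : d z y != 0.
    rewrite (dist_eq0 conn); apply/negP => /eqP zy; rewrite zy in exz.
    by case: (dist_parity tree r exz); rewrite !(distC conn sym _ r) eqd; lia.
  by rewrite /common; have := B_depth xB; lia.
move/leq_trans; apply; rewrite /common !Tlmp_root_dist dist0.
have posx := pos_coside_map x; have posy := pos_coside_map y.
rewrite posx posy; have := depth_le_rank xB; have := depth_le_rank yB.
move: neq_rank; clear -dist0P posx posy D_gt0 D_lt l_gt0 m_gt0.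
case: (dist0P (coside_map x) (coside_map y)) => -[_]; rewrite posx posy.
- by move=> eqp ->; lia.
- by move=> eqp _ ->; lia.
- by move=> neqp ->; lia.
Qed.

End Coside.

End Embedding.

End AlongGeodesic.
(** * The extremal property *)

Section SetDistance.
Variables (V : finType) (e : rel V).
Implicit Types (A B : {set V}).

Lemma bigmin_le (I : finType) (P : pred I) (F : I -> nat) (N : nat) i :
  P i -> \big[minn/N]_(j | P j) F j <= F i.
Proof.
move=> Pi; rewrite -big_filter; have : i \in [seq j <- index_enum I | P j].
  by rewrite mem_filter Pi mem_index_enum.
elim: [seq _ <- _ | _] => // j s IHs; rewrite big_cons inE geq_min.
by case/orP=> [/eqP ->|/IHs ->]; rewrite ?leqnn ?orbT.
Qed.

Lemma set_dist_le A B x y : x \in A -> y \in B -> set_dist e A B <= dist e x y.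
Proof.
move=> xA yB; apply: leq_trans (bigmin_le _ _ xA) _; exact: bigmin_le.
Qed.

(** The bound [N <= #|V|] takes care of the default value of the minima. *)
Lemma set_dist_ge A B N : N <= #|V| ->
  (forall x y, x \in A -> y \in B -> N <= dist e x y) -> N <= set_dist e A B.
Proof.
move=> leNV le; rewrite /set_dist.
elim/big_ind: _ => // [i j lei lej|x xA]; first by rewrite leq_min lei.
elim/big_ind: _ => // [i j lei lej|y yB]; first by rewrite leq_min lei.
exact: le.
Qed.

End SetDistance.

Lemma dist_le_diameter (V : finType) (e : rel V) x y : dist e x y <= diameter e.
Proof.
apply: leq_trans (leq_bigmax (F := fun u => \max_v dist e u v) x).
exact: (leq_bigmax (F := dist e x) y).
Qed.

Section Extremal.
Variables (R : realType) (l m p : nat).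
Hypotheses (l_gt0 : 0 < l) (m_gt0 : 0 < m) (p_gt0 : 0 < p) (hub_large : l + p <= m.+1).
Hypothesis m_half : m.*2 <= p + (l + m).
Local Notation V0 := ('I_p + ('I_l + 'I_m))%type.
Local Notation e0 := (@Tlmp l m p).

Variables (V : finType) (e : rel V).
Hypotheses (tree : is_tree e) (cardV : #|V| = p + (l + m)) (diam : diameter e = p.+1).
Variables (X : {set {set V}}) (X0 : {set {set V0}}).
Hypotheses (charX : is_characteristic_set R e X) (charX0 : is_characteristic_set R e0 X0).

Let conn := tree_conn tree.
Let sym := tree_sym tree.
Local Notation d := (dist e).

Lemma centroid_dist_le_Tlmp : centroid_dist e X <= centroid_dist e0 X0.
Proof.
have [mu [y [lapy ray [x0 x0X] coverX]]] := characteristic_setP tree charX.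
have tree0 := Tlmp_tree l_gt0 m_gt0 p_gt0.
have [mu0 [y0 [lapy0 ray0 _ coverX0]]] := characteristic_setP tree0 charX0.
have [c0 c0C] : exists c0, c0 \in centroid e.
  case: (arg_minnP (weight e) (isT : xpredT x0)) => c0 _ cmin.
  by exists c0; rewrite inE; apply/forallP => v; exact: cmin.
pose pairs := [pred z : V * V | (z.1 \in centroid e) && (z.2 \in cover X)].
have pair0 : pairs (c0, x0) by rewrite /= c0C.
case: (arg_minnP (fun z => d z.1 z.2) pair0) => -[c r] /= /andP[cC rX] minimal.
have {}minimal c' r' : c' \in centroid e -> r' \in cover X -> d c r <= d c' r'.
  by move=> c'C r'X; apply: (minimal (c', r')); rewrite /= c'C.
apply: leq_trans (set_dist_le e cC rX) _.
have dV : d c r < #|V| := dist_lt conn c r.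
have [->//|D_gt0] := posnP (d c r); set D := d c r in D_gt0 minimal dV *.
have [u [u0 uD u_adj u_root]] := geodesic_exists tree c r.
rewrite -/D in uD u_adj u_root; rewrite -uD in u_root.
pose a := u D.-1; have ear : e a r by rewrite -uD; exact: (geodesic_last_adj D_gt0 u_adj).
(* By minimality of the pair, [u 1] is not in the centroid, nor [a] in the cover of [X]: either
   would give a smaller distance. *)
have u1C : u 1 \notin centroid e.
  apply/negP => u1C; have := minimal _ _ u1C rX.
  by rewrite -uD u_root //; lia.
have aX : a \notin cover X.
  apply/negP => aX; have := minimal _ _ cC aX.
  have := walk_dist tree u_adj (leq0n D.-1) (leq_pred D).
  by rewrite u0 -/a; clear -D_gt0; lia.
have ec1 : e c (u 1) by rewrite -u0; exact: u_adj.
(* More than half of the vertices lie on the side of [c], and by [m_half] half of them is at least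
   [m]; so [m] remain when [c] is removed. *)
have beyond_card : m <= #|side e (u 0) (u 1) :\ u 0|.
  have := centroid_side tree ec1 cC u1C; rewrite u0 (cardsD1 c) side_root // cardV.
  by clear -m_half; lia.
have [f [supf f_gt0 Ef]] := coside_low_energy tree ear lapy coverX rX aX.
(* The nonzero [f] provides a vertex of the coside; this forces [D < p] and leaves room for [r0] on
   the path. *)
have [b bB] : exists b, b \in coside e a r.
  have [b fb] := dot_gt0P f_gt0; exists b.
  by apply: contraNT fb => /supf ->.
(* Some [w] beyond [c] is at distance at least [D + 1] from [r], and its path to [b'] goes through
   [r]; its length is at most the diameter. *)
have far b' : b' \in coside e a r -> d r b' + D.+1 <= p.+1.
  rewrite in_coside => /andP[_ b'A].
  have /card_gt0P[w] : 0 < #|side e (u 0) (u 1) :\ u 0| by exact: leq_trans beyond_card.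
  rewrite in_setD1 => /andP[nwc wb].
  have := beyond_root_dist tree D_gt0 u_adj u_root wb.
  have := beyond_side tree D_gt0 u_adj u_root wb.
  rewrite uD => wA wr; have := dist_side_root tree ear wA b'A.
  have := dist_le_diameter e w b'; rewrite diam.
  have : d (u 0) w != 0 by rewrite (dist_eq0 conn) eq_sym.
  by clear -wr; lia.
have D_lt : D < p.
  have := far b bB; have : d r b != 0.
    by rewrite (dist_eq0 conn) eq_sym; move: bB; rewrite in_coside => /andP[].
  by clear; lia.
set q := p.-1 - D.
have coside_depth b' : b' \in coside e a r -> d r b' <= q.+1.
  by move/far; rewrite /q; clear -D_lt; lia.
have coside_card : #|coside e a r| <= q + l.
  have := card_side_ge tree D_gt0 u_adj u_root; rewrite uD -/a.
  have := cardsC (r |: side e a r); rewrite cardsU1 sideN_root cardV /coside.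
  by rewrite /q; clear -D_lt beyond_card; lia.
rewrite -uD in ear coside_depth coside_card supf.
have outside := characteristic_outside_side tree tree0 ear
  (Tlmp_root_adj D_gt0 l_gt0 m_gt0 p_gt0 D_lt) ray ray0 lapy0 coverX0
  (side_map_in tree D_gt0 u_adj u_root l_gt0 m_gt0 D_lt beyond_card)
  (side_map_inj tree D_gt0 u_adj u_root l_gt0 m_gt0 D_lt beyond_card)
  (side_map_common tree D_gt0 u_adj u_root l_gt0 m_gt0 D_lt beyond_card)
  (coside_map_in D_gt0 l_gt0 m_gt0 p_gt0 D_lt coside_card)
  (coside_map_inj D_gt0 m_gt0 D_lt coside_card)
  (coside_map_common tree D_gt0 u_adj l_gt0 m_gt0 p_gt0 D_lt coside_card coside_depth)
  supf f_gt0 Ef.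
apply: set_dist_ge => [|v x vC xX]; first by rewrite Tlmp_card -cardV; exact: ltnW.
(* The centroid reduces to the last path vertex, at position [p], and all that lies outside the side
   of [a0] has position at most [p - D]. *)
rewrite (Tlmp_centroid l_gt0 m_gt0 p_gt0 hub_large vC) (Tlmp_dist l_gt0 m_gt0 p_gt0).
have := contraL (outside x) xX.
rewrite (Tlmp_side D_gt0 l_gt0 m_gt0 p_gt0 D_lt).
have := pos_last l_gt0 m_gt0 p_gt0.
clear -D_gt0 D_lt l_gt0 m_gt0.
by case: (broom_distP l_gt0 m_gt0 p_gt0 (pt l m p_gt0 p.-1) x) => -[*]; lia.
Qed.

End Extremal.

Theorem theorem4p5 (R : realType) (n k : nat) :
  3 <= k -> k <= uphalf n ->
  let T0 := @Tlmp (n - n./2 - k + 1) n./2 (k - 1) in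
  Gamma n k T0 /\
  forall (V : finType) (e : rel V), Gamma n k e ->
  forall (X : {set {set V}})
    (X0 : {set {set ('I_(k - 1) + ('I_(n - n./2 - k + 1) + 'I_(n./2)))%type}}),
  is_characteristic_set R e X -> is_characteristic_set R T0 X0 ->
  centroid_dist e X <= centroid_dist T0 X0.
Proof.
move=> k_ge3 k_le T0; have nE := odd_double_half n; rewrite uphalf_half in k_le.
have l_gt0 : 0 < n - n./2 - k + 1 by lia.
have m_gt0 : 0 < n./2 by lia.
have p_gt0 : 0 < k - 1 by lia.
have card0 : k - 1 + (n - n./2 - k + 1 + n./2) = n by lia.
have diam0 : (k - 1).+1 = k by lia.
split=> [|V e [cardV tree diam] X X0].
  split; first by rewrite Tlmp_card.
    exact: Tlmp_tree.
  by rewrite /T0 Tlmp_diameter.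
(* Here [l + p] is the upper half of [n], which exceeds its lower half [m] by at most 1. *)
apply: centroid_dist_le_Tlmp => //; rewrite ?card0 ?diam0 //; lia.
Qed.
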